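(* Let $n\to\infty$ and let ${\bf d}=(d_1,\ldots,d_n)$ be a degree sequence with $M=\sum_i d_i$ even and $\Delta^2=o(M)$, where $\Delta=\max_i d_i$. Let $H_1,H_2$ be graphs on $[n]$ with $E(H_1)\cap E(H_2)=\emptyset$, such that $d^{H_1}_i\le d_i$ for all $i$ and the maximum degree of $H_2$ is $O(\Delta)$. Let $\widetilde{{\bf d}}={\bf d}-{\bf d}^{H_1}$, $\widetilde M=\sum_i\widetilde d_i$ $(=M-2|H_1|)$ and $\widetilde M_2=\sum_i \widetilde d_i(\widetilde d_i-1)$, and suppose $\widetilde M=\Omega(M)$. Let $uv\notin H_1\cup H_2$. Then \[ {\mathbb P}\big(uv\in{\mathcal G}(n,{\bf d})\mid H_1^+,H_2^-\big)=\left(1+O\!\left(\frac{\Delta^5 n}{M^3}\right)\right)\frac{\widetilde d_u\widetilde d_v}{\widetilde M}\left(1-\frac{\widetilde M_2^2}{\widetilde M^3}-\frac{\widetilde M_2}{\widetilde M^2}-\sum_{(x,y)\in{\mathcal W}}\frac{\widetilde d_x\widetilde d_y}{\widetilde M^2}\right)\left(1-\frac{\bar\phi_{H_1}(uv)}{\widetilde M}\right), \] where \[ \bar\phi_{H_1}(uv)=-2(\widetilde d_u+\widetilde d_v)+2-\sum_{x\in{\mathcal N}_{H_1\cup H_2}(u)}\widetilde d_x-\sum_{y\in{\mathcal N}_{H_1\cup H_2}(v)}\widetilde d_y-\frac{(\widetilde d_u+\widetilde d_v-2)\widetilde M_2}{\widetilde M}+\widetilde d_u\widetilde d_v, \] and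 ${\mathcal W}$ is the set of ordered pairs $(x,y)$ of vertices with $xy\in H_1\cup H_2$, $xu\notin H_1\cup H_2$, $yv\notin H_1\cup H_2$, and $\{x,y\}\cap\{u,v\}=\emptyset$.
   Context: ${\mathcal G}(n,{\bf d})$ denotes a uniformly random simple graph on vertex set $[n]$ with degree sequence ${\bf d}$. For a graph $H$ on $[n]$, ${\bf d}^H=(d^H_1,\ldots,d^H_n)$ is its degree sequence, $|H|$ its number of edges, and ${\mathcal N}_H(u)$ the set of neighbours of $u$ in $H$. $H_1^+$ denotes the event $H_1\subseteq{\mathcal G}(n,{\bf d})$ and $H_2^-$ the event that ${\mathcal G}(n,{\bf d})$ contains no edge of $H_2$. Asymptotic notation is as $n\to\infty$; all parameters may depend on $n$. *)

(* Defs.v *)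
From HB Require Import structures.
From mathcomp Require Import all_boot all_order all_algebra.
From mathcomp Require Import reals.
Set Implicit Arguments. Unset Strict Implicit. Unset Printing Implicit Defensive.
Import Order.TTheory GRing.Theory Num.Theory.
Local Open Scope ring_scope.

Section GraphDefs.
Variable n : nat.
(* A graph on [n] (vertex set 'I_n) is given by its edge set: a set of
   2-element subsets of 'I_n. *)
Definition graph := {set {set 'I_n}}.

Definition edge (x y : 'I_n) : {set 'I_n} := [set x; y].

Definition is_graph (G : graph) : bool := [forall e in G, #|e| == 2%N].

Definition deg (G : graph) (i : 'I_n) : nat := #|[set e in G | i \in e]|.

Definition nbr (G : graph) (u : 'I_n) : {set 'I_n} :=
  [set x | edge u x \in G].

Definition maxdeg (G : graph) : nat := (\max_(i : 'I_n) deg G i)%N.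

Definition Delta (d : 'I_n -> nat) : nat := (\max_(i : 'I_n) d i)%N.
Definition sumdeg (d : 'I_n -> nat) : nat := (\sum_(i : 'I_n) d i)%N.

Definition graphs_deg (d : 'I_n -> nat) : {set graph} :=
  [set G : graph | is_graph G && [forall i, deg G i == d i]].

Definition cond_graphs (d : 'I_n -> nat) (H1 H2 : graph) : {set graph} :=
  [set G in graphs_deg d | (H1 \subset G) && [disjoint H2 & G]].

Definition condprob (R : realType) (d : 'I_n -> nat) (H1 H2 : graph)
  (u v : 'I_n) : R :=
  (#|[set G in cond_graphs d H1 H2 | edge u v \in G]|)%:R
  / (#|cond_graphs d H1 H2|)%:R.

Variable R : realType.
Variables (d : 'I_n -> nat) (H1 H2 : graph).

Definition dt (i : 'I_n) : R := ((d i - deg H1 i)%N)%:R.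
Definition Mt : R := \sum_(i : 'I_n) dt i.
Definition M2t : R := \sum_(i : 'I_n) dt i * (dt i - 1).

Definition H12 : graph := H1 :|: H2.

Definition phibar (u v : 'I_n) : R :=
  - 2 * (dt u + dt v) + 2
  - (\sum_(x in nbr H12 u) dt x) - (\sum_(y in nbr H12 v) dt y)
  - (dt u + dt v - 2) * M2t / Mt + dt u * dt v.

Definition Wset (u v : 'I_n) : {set 'I_n * 'I_n} :=
  [set p : 'I_n * 'I_n | [&& edge p.1 p.2 \in H12,
                             edge p.1 u \notin H12,
                             edge p.2 v \notin H12,
                             p.1 \notin [set u; v] &
                             p.2 \notin [set u; v]]].

Definition main_term (u v : 'I_n) : R :=
  dt u * dt v / Mt
  * (1 - M2t ^+ 2 / Mt ^+ 3 - M2t / Mt ^+ 2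
       - \sum_(p in Wset u v) dt p.1 * dt p.2 / Mt ^+ 2)
  * (1 - phibar u v / Mt).

End GraphDefs.

Definition littleo (R : realType) (f g : nat -> R) : Prop :=
  forall eps : R, 0 < eps -> exists K : nat, forall k, (K <= k)%N ->
    `|f k| <= eps * `|g k|.

Definition bigO (R : realType) (f g : nat -> R) : Prop :=
  exists C : R, 0 < C /\ exists K : nat, forall k, (K <= k)%N ->
    `|f k| <= C * `|g k|.

(* Main.v *)
Require Import Defs.
From HB Require Import structures.
From mathcomp Require Import all_boot all_order all_algebra.
From mathcomp Require Import reals.
From mathcomp Require Import ring lra zify.
Set Implicit Arguments. Unset Strict Implicit. Unset Printing Implicit Defensive.
Import Order.TTheory GRing.Theory Num.Theory.
Local Open Scope ring_scope.

(** Write t for the residual degrees and H for the union of H1 and H2.  A switching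
    deletes two edges uv, xy and inserts ux, vy.  Counting the switchings from
    the graphs containing uv to those avoiding it in two ways gives
    N(uv in) E[fwd | uv in] = N(uv out) E[bwd | uv out], where fwd and bwd are
    the numbers of admissible pairs (x, y).  By inclusion-exclusion fwd is
    M minus the weight of edges meeting u, v or a neighbour of u or v, and bwd is
    t_u t_v minus the numbers of common neighbours of u and v, of 3-paths u x y v
    and of paths u x y v with xy in H, so their expectations only need
    probabilities that one, two or three given edges are present.  Since a
    conditioned model is again of the same form, with edges moved into H1 or H2,
    these follow from the same switching: first the upper bound 2 t_a t_b / M for
    one edge, then its iterates, then two-sided estimates with relative error
    O(D^2 / M).  The corrections being themselves O(D^2 / M), the final relative
    error is O(D^4 / M^2), which is at most Delta^5 n / M^3 because
    M <= n Delta. *)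

(** * Switching two edges *)

(** The obstacle is circularity: the averages of the two switching counts involve the very
    probabilities that are sought. It is resolved because these probabilities enter only through
    corrections that are smaller than the leading terms by a factor O(D^2 / M). An upper bound that
    is off by a constant factor thus already fixes the averages up to a relative O(D^2 / M), and
    each further round gains the same factor; two rounds suffice.

    All statements concern unnormalised sums, cleared of denominators by powers of M, because
    prescribing an edge can leave an empty class, over which no average exists.

    The double count determines odds rather than a probability. With rho = t_u t_v / M and f =
    phibar / M it reads p (1 + f - rho) = rho (1 - p) (1 - w) up to error, where M (1 + f - rho) is
    the mean of fwd, t_u t_v (1 - w) is the mean of bwd, and w collects the three corrections of the
    first bracket. The summand t_u t_v of phibar is therefore the price of passing from p / (1 - p)
    to p, and the factor 1 - f is the inverse of 1 + f to first order. *)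

Section Graphs.
Variable n : nat.
Implicit Types (A B G X : {set {set 'I_n}}) (e : {set 'I_n}) (i u v x y : 'I_n).

Lemma edgeC x y : edge x y = edge y x.
Proof. by rewrite /edge setUC. Qed.

Lemma in_edge i x y : (i \in edge x y) = (i == x) || (i == y).
Proof. by rewrite !inE. Qed.

Lemma edge_eq a b x y :
  (edge a b == edge x y) = ((a == x) && (b == y)) || ((a == y) && (b == x)).
Proof.
apply/eqP/idP => [E|].
  have := in_edge a x y; rewrite -E in_edge eqxx /=.
  have := in_edge b x y; rewrite -E in_edge eqxx orbT.
  have := in_edge x a b; rewrite E in_edge eqxx.
  have := in_edge y a b; rewrite E in_edge eqxx orbT.
  rewrite !(eq_sym _ a) !(eq_sym _ b).
  by case: (a == x); case: (a == y); case: (b == x); case: (b == y).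
by case/orP=> /andP[/eqP-> /eqP->] //; rewrite edgeC.
Qed.

Lemma edgexx_notin G x : is_graph G -> edge x x \notin G.
Proof.
move=> /forallP/(_ (edge x x)); apply: contraL => ->.
by rewrite /edge setUid cards1.
Qed.

Lemma is_graphP G : reflect (forall e, e \in G -> #|e| = 2%N) (is_graph G).
Proof.
by apply: (iffP forallP) => [h e eG|h e]; [move: (h e); rewrite eG => /eqP|
  apply/implyP => /h ->].
Qed.

Lemma deg_sum G i : deg G i = (\sum_(e in G) (i \in e))%N.
Proof.
rewrite /deg -sum1_card -big_mkcondr /=.
by apply: eq_bigl => e; rewrite inE.
Qed.

Lemma is_graphU1 u v G : u != v -> is_graph G -> is_graph (edge u v |: G).
Proof.
move=> uv /is_graphP h; apply/is_graphP => e /setU1P[->|/h//].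
by rewrite /edge cards2 uv.
Qed.

Lemma is_graph_sub G G' : G \subset G' -> is_graph G' -> is_graph G.
Proof. by move=> /subsetP s /is_graphP h; apply/is_graphP => e /s/h. Qed.

Lemma degU1 e G i : e \notin G -> deg (e |: G) i = ((i \in e) + deg G i)%N.
Proof. by move=> eG; rewrite !deg_sum big_setU1. Qed.

Lemma degD1 e G i : e \in G -> deg G i = ((i \in e) + deg (G :\ e) i)%N.
Proof. by move=> eG; rewrite !deg_sum (big_setD1 e). Qed.

Lemma degU1_le e G i : (deg (e |: G) i <= (deg G i).+1)%N.
Proof.
have [eG|eG] := boolP (e \in G); first by rewrite (setUidPr _) ?sub1set.
by rewrite degU1 //; case: (i \in e).
Qed.

Lemma deg_nbr G i : is_graph G -> deg G i = (\sum_y (edge i y \in G))%N.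
Proof.
move=> gG; rewrite -big_mkcond sum1_card /deg.
rewrite -(@card_in_imset _ _ (edge i) [pred y | edge i y \in G]); last first.
  move=> y z _ _ /eqP; rewrite edge_eq eqxx /= => /orP[/eqP//|].
  by case/andP => /eqP-> /eqP->.
apply: eq_card => e; rewrite inE; apply/andP/imsetP => [[eG ie]|[y yG ->]].
  have /eqP/cards2P[a [b [ab eE]]] := is_graphP _ gG e eG; rewrite -/(edge a b) in eE.
  rewrite eE in eG ie *.
  move: ie; rewrite !inE => /orP[]/eqP->.
    by exists b.
  by exists a; rewrite ?inE edgeC //.
by rewrite in_edge eqxx.
Qed.

Lemma disjointsU1 e A B : [disjoint e |: A & B] = (e \notin B) && [disjoint A & B].
Proof. by rewrite (disjoints_subset (e |: A)) subUset sub1set inE -disjoints_subset. Qed.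

Variable d : 'I_n -> nat.

Lemma in_cond G A B : (G \in cond_graphs d A B) =
  [&& is_graph G, [forall i, deg G i == d i], A \subset G & [disjoint B & G]].
Proof. by rewrite !inE -!andbA. Qed.

(** Conditioning on one more edge stays inside the family, so bounds proved for all [A] and [B] can
    be iterated. *)
Lemma cond_graphsU1l e A B :
  cond_graphs d (e |: A) B = [set G in cond_graphs d A B | e \in G].
Proof.
apply/setP => G; rewrite inE !in_cond subUset sub1set.
by case: (e \in G); rewrite ?andbT ?andbF //= !andbF.
Qed.

Lemma cond_graphsU1r e A B :
  cond_graphs d A (e |: B) = [set G in cond_graphs d A B | e \notin G].
Proof.
apply/setP => G; rewrite inE !in_cond disjointsU1.
by case: (e \in G); rewrite ?andbT ?andbF.
Qed.

Lemma in_condU1l G e A B : (G \in cond_graphs d (e |: A) B) =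
  (G \in cond_graphs d A B) && (e \in G).
Proof. by rewrite cond_graphsU1l in_set. Qed.

Lemma in_condU1r G e A B : (G \in cond_graphs d A (e |: B)) =
  (G \in cond_graphs d A B) && (e \notin G).
Proof. by rewrite cond_graphsU1r in_set. Qed.

(** The graphs on which the switching may act. Exchanging [v] and [x] gives the graphs on which the
    reverse switching may act. *)
Definition swpre A B u v x y : {set {set {set 'I_n}}} :=
  [set G in cond_graphs d A B | [&& edge u v \in G, edge x y \in G,
    edge u x \notin G & edge v y \notin G]].

(** The switching is injective, its left inverse being the reverse exchange. It stays in the class
    when the deleted edges are not prescribed and the inserted ones not forbidden. *)
Lemma switch_le A B u v x y : uniq [:: u; v; x; y] ->
  edge u v \notin A -> edge x y \notin A ->
  edge u x \notin B -> edge v y \notin B ->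
  (#|swpre A B u v x y| <= #|swpre A B u x v y|)%N.
Proof.
move=> uq uvA xyA uxB vyB.
move: (uq); rewrite /= !inE !negb_or -!andbA => /and4P[uv ux uy /and4P[vx vy xy _]].
have [n1 [n2 n3 n4 n5 n6]] : (edge u v == edge x y) = false /\
 [/\ (edge u x == edge u v) = false,
   (edge u x == edge x y) = false, (edge v y == edge u v) = false,
   (edge v y == edge x y) = false & (edge u x == edge v y) = false].
  rewrite !edge_eq !(eq_sym v u) !(eq_sym x v) !(eq_sym x u) !(eq_sym y u).
  rewrite !(eq_sym y v) !(eq_sym y x).
  rewrite (negbTE uv) (negbTE ux) (negbTE uy) (negbTE vx) (negbTE vy) (negbTE xy).
  by rewrite !andbF.
pose sw G := edge u x |: (edge v y |: ((G :\ edge u v) :\ edge x y)).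
have swK : {in swpre A B u v x y, cancel sw (fun G =>
   edge u v |: (edge x y |: ((G :\ edge u x) :\ edge v y)))}.
  move=> G; rewrite inE => /and5P[_ uvG xyG uxG vyG]; apply/setP => e.
  rewrite !inE.
  have [->|_] /= := eqVneq e (edge u v); first by rewrite uvG.
  have [->|_] /= := eqVneq e (edge x y); first by rewrite xyG.
  have [->|_] /= := eqVneq e (edge v y); first by rewrite (negbTE vyG).
  by have [->|_] /= := eqVneq e (edge u x); first by rewrite (negbTE uxG).
have sw_inj : {in swpre A B u v x y &, injective sw} 
  by move=> G G' GS G'S E; rewrite -(swK G GS) E swK.
rewrite -(card_in_imset sw_inj); apply/subset_leq_card/subsetP => _ /imsetP[G Gpre ->].
move: Gpre; rewrite inE => /and5P[GS uvG xyG uxG vyG].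
rewrite inE in_cond; move: GS; rewrite in_cond => /and4P[gG dG AG BG].
have swG0 : is_graph (G :\ edge u v :\ edge x y).
  by apply: is_graph_sub gG; rewrite (subset_trans (subsetDl _ _)) ?subsetDl.
apply/andP; split; last first.
  rewrite /sw !inE !eqxx !orbT.
  by rewrite !(eq_sym (edge u v)) !(eq_sym (edge x y)) n2 n3 n4 n5 ?eqxx /= ?andbF ?n1.
apply/and4P; split.
- by rewrite !is_graphU1.
(* Each of the four vertices lies in exactly one deleted and one inserted edge, so all degrees are
   kept. *)
- apply/forallP => i; rewrite -(eqP (forallP dG i)) /sw.
  rewrite !degU1; last first.
  + by rewrite !inE n6 n2 n3 (negbTE uxG).
  + by rewrite !inE n4 n5 (negbTE vyG).
  have xyG' : edge x y \in G :\ edge u v by rewrite !inE eq_sym n1.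
  rewrite (degD1 i uvG) (degD1 i xyG').
  rewrite !addnA eqn_add2r !in_edge.
  have [->|iu] := eqVneq i u.
    by rewrite (negbTE uy) (negbTE uv) (negbTE ux).
  have [->|iv] := eqVneq i v; first by rewrite (negbTE vx) (negbTE vy).
  by have [->|ix] := eqVneq i x; rewrite ?(negbTE xy).
- apply/subsetP => e eA; rewrite !inE.
  rewrite (subsetP AG e eA) andbT.
  have -> : (e == edge u v) = false by apply: contraNF uvA => /eqP<-.
  have -> : (e == edge x y) = false by apply: contraNF xyA => /eqP<-.
  by rewrite !orbT.
- rewrite disjoint_sym !disjointsU1 uxB vyB /=.
  rewrite disjoint_sym; apply: disjointWr BG.
  by rewrite (subset_trans (subsetDl _ _)) ?subsetDl.
Qed.

(** The reverse switching is the same construction with [v] and [x] exchanged, so the injection is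
    applied in both directions. *)
Lemma switch_card A B u v x y : uniq [:: u; v; x; y] ->
  edge u v \notin A :|: B -> edge x y \notin A :|: B ->
  edge u x \notin A :|: B -> edge v y \notin A :|: B ->
  #|swpre A B u v x y| = #|swpre A B u x v y|.
Proof.
move=> uq; rewrite !inE !negb_or => /andP[? ?] /andP[? ?] /andP[? ?] /andP[? ?].
apply/eqP; rewrite eqn_leq !switch_le //.
move: uq; rewrite /= !inE !negb_or -!andbA (eq_sym x v).
by case/and4P => -> -> -> /and4P[-> -> ->].
Qed.
End Graphs.

(** * Sums over the conditioned model *)

Section Expect.
Variables (R : realType) (n : nat) (d : 'I_n -> nat).
Implicit Types (A B G X : {set {set 'I_n}}) (e : {set 'I_n}) (i u v x y : 'I_n).

Definition edge_ind X x y : R := (edge x y \in X)%:R.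
Local Notation ind := edge_ind.

Definition cnt A B : R := #|cond_graphs d A B|%:R.

Definition Esum A B (F : {set {set 'I_n}} -> R) : R :=
  \sum_(G in cond_graphs d A B) F G.

Lemma ind_ge0 X x y : 0 <= ind X x y. Proof. exact: ler0n. Qed.
Lemma indC X x y : ind X x y = ind X y x. Proof. by rewrite /edge_ind edgeC. Qed.
Lemma indxx X x : is_graph X -> ind X x x = 0.
Proof. by move=> gX; rewrite /edge_ind (negbTE (edgexx_notin x gX)). Qed.

Lemma cnt_ge0 A B : 0 <= cnt A B. Proof. exact: ler0n. Qed.

Lemma Esum_const A B c : Esum A B (fun=> c) = c * cnt A B.
Proof. by rewrite /Esum sumr_const mulr_natr. Qed.

Lemma EsumD A B F F' : Esum A B (fun G => F G + F' G) = Esum A B F + Esum A B F'.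
Proof. exact: big_split. Qed.

Lemma EsumN A B F : Esum A B (fun G => - F G) = - Esum A B F.
Proof. exact: sumrN. Qed.

Lemma EsumZ A B c F : Esum A B (fun G => c * F G) = c * Esum A B F.
Proof. by rewrite /Esum mulr_sumr. Qed.

Lemma Esum_sum A B (I : finType) (F : I -> {set {set 'I_n}} -> R) :
  Esum A B (fun G => \sum_i F i G) = \sum_i Esum A B (F i).
Proof. exact: exchange_big. Qed.

Lemma eq_Esum A B F F' :
  (forall G, G \in cond_graphs d A B -> F G = F' G) -> Esum A B F = Esum A B F'.
Proof. exact: eq_bigr. Qed.

Lemma le_Esum A B F F' :
  (forall G, G \in cond_graphs d A B -> F G <= F' G) -> Esum A B F <= Esum A B F'.
Proof. exact: ler_sum. Qed.

Lemma Esum_ge0 A B F :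
  (forall G, G \in cond_graphs d A B -> 0 <= F G) -> 0 <= Esum A B F.
Proof. exact: sumr_ge0. Qed.

Lemma condP A B G : G \in cond_graphs d A B ->
  [/\ is_graph G, forall i, deg G i = d i, A \subset G & [disjoint B & G]].
Proof.
by rewrite in_cond => /and4P[? /forallP h ? ?]; split=> // i; apply/eqP.
Qed.

(** Row sums of the free edges are the same for every graph of the class; this is what makes the
    leading terms of both switching counts deterministic. *)
Lemma ind_sum A B G x : G \in cond_graphs d A B ->
  \sum_y ind (G :\: A) x y = dt R d A x.
Proof.
move=> /condP[gG dG AG _]; rewrite /dt -dG !deg_nbr ?(is_graph_sub AG) //.
rewrite -sumnB => [|y _]; last first.
  by case: (boolP (edge x y \in A)) => // /(subsetP AG) ->.
rewrite raddf_sum; apply: eq_bigr => y _; rewrite /edge_ind !inE.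
by case: (boolP (edge x y \in A)) => [/(subsetP AG) ->|] /=; rewrite ?subnn ?subn0.
Qed.

Lemma ind_sum_graph X x : is_graph X -> \sum_y ind X x y = (deg X x)%:R.
Proof. by move=> gX; rewrite deg_nbr // raddf_sum. Qed.

Lemma Esum_edge A B a b F : edge a b \notin A ->
  Esum A B (fun G => ind (G :\: A) a b * F G) = Esum (edge a b |: A) B F.
Proof.
move=> abA; rewrite /Esum [RHS]big_mkcond [LHS]big_mkcond /=.
apply: eq_bigr => G _; rewrite in_condU1l /edge_ind in_setD abA /=.
by case: (G \in cond_graphs d A B) => //=; case: (_ \in G); rewrite ?mul1r ?mul0r.
Qed.

Lemma Esum_edge1 A B a b : edge a b \notin A ->
  Esum A B (fun G => ind (G :\: A) a b) = cnt (edge a b |: A) B.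
Proof.
move=> abA; rewrite -[RHS]mul1r -Esum_const -Esum_edge //.
by apply: eq_Esum => G _; rewrite mulr1.
Qed.

Lemma cntD A B e : cnt A B = cnt (e |: A) B + cnt A (e |: B).
Proof.
rewrite /cnt cond_graphsU1l cond_graphsU1r -natrD; congr _%:R.
rewrite -(cardsID [set G : {set {set 'I_n}} | e \in G] (cond_graphs d A B)).
congr addn; apply: eq_card => G.
  by rewrite !inE.
by rewrite !inE andbC.
Qed.

Lemma cntU1r_le A B e : cnt A (e |: B) <= cnt A B.
Proof. by rewrite (cntD A B e) lerDr cnt_ge0. Qed.

Lemma ind_U1 G A a b x y : edge a b != edge x y ->
  ind (G :\: (edge a b |: A)) x y = ind (G :\: A) x y.
Proof. by move=> ne; rewrite /edge_ind !inE eq_sym (negbTE ne). Qed.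

Lemma ind_U1xx G A a b : ind (G :\: (edge a b |: A)) a b = 0.
Proof. by rewrite /edge_ind !inE eqxx. Qed.

(** * Indicators of admissible switchings *)

Lemma ind_notin G A B a b : G \in cond_graphs d A B -> edge a b \in A :|: B ->
  ind (G :\: A) a b = 0.
Proof.
move=> /condP[_ _ _ BG]; rewrite /edge_ind !inE.
by case: (edge a b \in A) => //= abB; rewrite (disjointFr BG abB).
Qed.

(** The two subtracted indicators exclude each other: [G :\: A] misses [A], and [G] avoids [B]. *)
Lemma ind_compl G A B x y : G \in cond_graphs d A B ->
  1 - ind (A :|: B) x y - ind (G :\: A) x y =
    ((edge x y \notin A :|: B) && (edge x y \notin G))%:R.
Proof.
move=> GS; have := @ind_notin G A B x y GS; rewrite /edge_ind !inE.
by case: (_ \in A); case: (_ \in B); case: (_ \in G) => //= h;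
  rewrite ?(h isT) ?subr0 ?subrr ?sub0r //; move: (h isT) => /eqP; rewrite oner_eq0.
Qed.

(* For G containing uv, adding [ind (G :\: (edge u v |: A)) u x] turns this into the
   indicator of x being u, v or a neighbour of u in G or in A :|: B. *)
Definition blk A B u v x : R :=
  (x == u)%:R + (x == v)%:R + ind (A :|: B) u x.

(* [fwd] is meant for graphs containing uv (with uv counted among the prescribed
   edges), [bwd] for graphs avoiding it. *)
Definition fwd A B u v G : R := \sum_x \sum_y
  ind (G :\: (edge u v |: A)) x y *
  (1 - blk A B u v x - ind (G :\: (edge u v |: A)) u x) *
  (1 - blk A B v u y - ind (G :\: (edge u v |: A)) v y).

Definition bwd A B u v G : R := \sum_x \sum_y
  ind (G :\: A) u x * ind (G :\: A) v y *
  (1 - (x == y)%:R - ind (G :\: A) x y - ind (A :|: B) x y).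

(** The conditions on [(x, y)] that do not depend on the graph. They are common to both directions,
    so the two counts can be compared pair by pair. *)
Definition switchable A B u v x y := [&& uniq [:: u; v; x; y], edge x y \notin A :|: B,
  edge u x \notin A :|: B & edge v y \notin A :|: B].

(** Since uv counts as prescribed, no indicator sees it, and the term [(x == v)] of [blk] alone
    excludes [x = v]. *)
Lemma blk0 A B u v x G : G \in cond_graphs d (edge u v |: A) B ->
  is_graph (A :|: B) -> u != v -> edge u v \notin A :|: B ->
  (x \in [:: u; v]) -> 1 - blk A B u v x - ind (G :\: (edge u v |: A)) u x = 0.
Proof.
move=> GS gH uv uvH; have [gG _ _ _] := condP GS; rewrite !inE => /orP[]/eqP->.
  rewrite /blk indxx // indxx ?(is_graph_sub (subsetDl _ _)) //.
  by rewrite eqxx (negbTE uv) !addr0 subr0 subrr.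
rewrite /blk ind_U1xx eqxx eq_sym (negbTE uv) /edge_ind (negbTE uvH).
by rewrite addr0 add0r subrr subr0.
Qed.

(** Degenerate pairs, with [x = y] or with [x] or [y] among [u] and [v], contribute zero, so [fwd]
    counts genuine switchings only. *)
Lemma fwd_term A B u v x y G : G \in cond_graphs d (edge u v |: A) B ->
  is_graph (A :|: B) -> u != v -> edge u v \notin A :|: B ->
  ind (G :\: (edge u v |: A)) x y *
  (1 - blk A B u v x - ind (G :\: (edge u v |: A)) u x) *
  (1 - blk A B v u y - ind (G :\: (edge u v |: A)) v y) =
  (switchable A B u v x y && [&& edge x y \in G, edge u x \notin G & edge v y \notin G])%:R.
Proof.
move=> GS gH uv uvH; have [gG _ _ _] := condP GS.
have GS0 : G \in cond_graphs d A B by move: GS; rewrite in_condU1l => /andP[].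
have [xuv|xuv] := boolP (x \in [:: u; v]).
  rewrite (blk0 GS) // mulr0 mul0r /switchable.
  by move: xuv; rewrite /= !inE => /orP[]/eqP->; rewrite eqxx ?orbT /= ?andbF.
have [yuv|yuv] := boolP (y \in [:: u; v]).
  have := @blk0 A B v u y G; rewrite (edgeC v u) => -> //; last 2 first.
  - by rewrite eq_sym.
  - by move: yuv; rewrite !inE orbC.
  rewrite mulr0 /switchable.
  by move: yuv; rewrite /= !inE => /orP[]/eqP->; rewrite eqxx ?orbT /= ?andbF.
have [->|xy] := eqVneq x y.
  rewrite indxx ?(is_graph_sub (subsetDl _ _)) // !mul0r /switchable /= !inE eqxx.
  by rewrite !andbF.
move: xuv yuv; rewrite !inE !negb_or => /andP[xu xv] /andP[yu yv].
have xyuv : edge u v != edge x y.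
  by rewrite edge_eq !(eq_sym u) (negbTE xu) (negbTE yu).
have uxuv : edge u v != edge u x.
  by rewrite edge_eq eqxx /= (eq_sym v) (eq_sym u x) (negbTE xv) (negbTE xu).
have vyuv : edge u v != edge v y.
  by rewrite edge_eq (negbTE uv) (eq_sym u y) (negbTE yu).
rewrite !ind_U1 // /blk (negbTE xu) (negbTE xv) (negbTE yu) (negbTE yv) !add0r.
rewrite !(ind_compl _ _ GS0) /switchable /= !inE !negb_or uv (eq_sym u x) xu (eq_sym u y) yu
  (eq_sym v x) xv (eq_sym v y) yv xy /=.
have := @disjointFl _ B G (edge x y); have [_ _ _ BG] := condP GS0.
move=> /(_ BG); rewrite /edge_ind in_setD.
case: (edge x y \in G) => [/(_ isT)->|_]; last by rewrite !andbF !mul0r.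
rewrite !andbT -!natrM !mulnb; congr ((nat_of_bool _)%:R).
by case: (edge x y \in A); case: (edge u x \in A); case: (edge v y \in A);
  rewrite ?andbF //=; case: (edge u x \in B); case: (edge v y \in B);
  rewrite ?andbF //=; case: (edge u x \in G).
Qed.

(** Here [x = v] and [y = u] drop out because [G] avoids uv, and [x = y] because of the explicit
    subtraction. *)
Lemma bwd_term A B u v x y G : G \in cond_graphs d A (edge u v |: B) ->
  is_graph (A :|: B) -> u != v -> 
  ind (G :\: A) u x * ind (G :\: A) v y *
  (1 - (x == y)%:R - ind (G :\: A) x y - ind (A :|: B) x y) =
  (switchable A B u v x y && [&& edge u x \in G, edge v y \in G & edge x y \notin G])%:R.
Proof.
move=> GS gH uv; have [gG _ _ _] := condP GS.
move: (GS); rewrite in_condU1r => /andP[GS0 uvG].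
have gA := is_graph_sub (subsetDl G A) gG.
have iuv : ind (G :\: A) u v = 0 by rewrite /edge_ind in_setD (negbTE uvG) andbF.
have [->|xu] := eqVneq x u.
  by rewrite indxx // !mul0r /switchable /= !inE eqxx ?orbT /= ?andbF.
have [->|xv] := eqVneq x v.
  by rewrite iuv !mul0r /switchable /= !inE eqxx ?orbT /= ?andbF.
have [->|yu] := eqVneq y u.
  by rewrite (indC _ v) iuv mulr0 mul0r /switchable /= !inE eqxx ?orbT /= ?andbF.
have [->|yv] := eqVneq y v.
  by rewrite indxx // mulr0 !mul0r /switchable /= !inE eqxx ?orbT /= ?andbF.
have [->|xy] := eqVneq x y.
  rewrite !indxx // subrr !subr0 mulr0 /switchable /= !inE eqxx /=.
  by rewrite !andbF.
have -> : 1 - false%:R - ind (G :\: A) x y - ind (A :|: B) x y =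
    ((edge x y \notin A :|: B) && (edge x y \notin G))%:R :> R.
  by rewrite -(ind_compl _ _ GS0) subr0 addrAC.
rewrite /switchable /= !inE !negb_or uv (eq_sym u x) xu (eq_sym u y) yu
  (eq_sym v x) xv (eq_sym v y) yv xy /=.
have [_ _ _ BG] := condP GS0.
have := @disjointFl _ B G (edge u x) BG; have := @disjointFl _ B G (edge v y) BG.
rewrite /edge_ind !in_setD.
case: (edge u x \in G) => [vyB /(_ isT)->|_ _]; last by rewrite !andbF !mul0r.
case: (edge v y \in G) vyB => [/(_ isT)->|_]; last by rewrite !andbF !mulr0 !mul0r.
rewrite !andbT -!natrM !mulnb; congr ((nat_of_bool _)%:R).
by case: (edge x y \in A); case: (edge u x \in A); case: (edge v y \in A);
  rewrite ?andbF //=; case: (edge x y \in B); idtac;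
  rewrite ?andbF //=; case: (edge x y \in G).
Qed.

Lemma sum_bool (S : {set {set {set 'I_n}}}) (P : pred {set {set 'I_n}}) (b : bool) :
  \sum_(G in S) (b && P G)%:R = (if b then #|[set G in S | P G]|%:R else 0) :> R.
Proof.
case: b; last by rewrite big1.
rewrite -sum1_card raddf_sum [RHS]big_mkcond [LHS]big_mkcond /=.
by apply: eq_bigr => G _; rewrite in_set; case: (G \in S) => //; case: (P G).
Qed.

(* Deleting uv, xy and inserting ux, vy matches the two counts pair (x, y) by
   pair. *)
Lemma switching A B u v : is_graph (A :|: B) -> u != v ->
  edge u v \notin A :|: B ->
  Esum (edge u v |: A) B (fwd A B u v) = Esum A (edge u v |: B) (bwd A B u v).
Proof.
move=> gH uv uvH; rewrite /fwd /bwd !Esum_sum; apply: eq_bigr => x _.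
rewrite !Esum_sum; apply: eq_bigr => y _.
rewrite /Esum (eq_bigr _ (fun G GS => @fwd_term A B u v x y G GS gH uv uvH)).
rewrite (eq_bigr _ (fun G GS => @bwd_term A B u v x y G GS gH uv)).
rewrite !sum_bool; case: ifP => // /and4P[uq xyH uxH vyH]; congr _%:R.
transitivity #|swpre d A B u v x y|.
  by apply: eq_card => G; rewrite [LHS]in_set in_condU1l [RHS]in_set -!andbA.
rewrite switch_card //; apply: eq_card => G; rewrite [LHS]in_set [RHS]in_set in_condU1r.
by case: (edge u v \in G); rewrite ?andbF ?andbT.
Qed.
End Expect.

(** * Residual degrees after prescribing an edge *)

Section Degrees.
Variables (R : realType) (n : nat) (d : 'I_n -> nat).
Implicit Types (A B G X : {set {set 'I_n}}) (e : {set 'I_n}) (i u v x y : 'I_n).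
Local Notation t := (dt R d).
Local Notation M := (Mt R d).

Lemma dt_ge0 A i : 0 <= t A i. Proof. exact: ler0n. Qed.

Lemma Mt_ge0 A : 0 <= M A. Proof. by apply: sumr_ge0 => i _; exact: dt_ge0. Qed.

Lemma dtU1_le e A i : t (e |: A) i <= t A i.
Proof.
rewrite /dt ler_nat leq_sub2l //.
have [eA|eA] := boolP (e \in A); first by rewrite (setUidPr _) ?sub1set.
by rewrite degU1 // leq_addl.
Qed.

Lemma dtU1_ge e A i : e \notin A -> t A i - (i \in e)%:R <= t (e |: A) i.
Proof.
move=> eA; rewrite /dt degU1 // lerBlDr -natrD ler_nat.
by case: (i \in e) => /=; lia.
Qed.

Lemma dtU1_notin e A i : e \notin A -> i \notin e -> t (e |: A) i = t A i.
Proof. by move=> eA ie; rewrite /dt degU1 // (negbTE ie). Qed.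

(** Positivity guards against truncation, residual degrees being differences of naturals. *)
Lemma dtU1_in e A i : e \notin A -> i \in e -> 0 < t A i -> t (e |: A) i = t A i - 1.
Proof.
move=> eA ie; rewrite /dt degU1 // ie ltr0n => h.
by apply/eqP; rewrite eq_sym subr_eq natr1 eqr_nat; lia.
Qed.

(** The factor [t A i] absorbs the truncated case. A vertex lying on two prescribed edges thus
    contributes a falling factorial, the summand of [M2t]. *)
Lemma dtMU1 e A i : e \notin A -> i \in e -> t A i * t (e |: A) i = t A i * (t A i - 1).
Proof.
move=> eA ie; have := dt_ge0 A i; rewrite le_eqVlt => /orP[/eqP<-|h].
  by rewrite !mul0r.
by rewrite dtU1_in.
Qed.

Lemma sum_eq1 u : \sum_x (x == u)%:R = 1 :> R.
Proof. by rewrite (bigD1 u) //= eqxx big1 ?addr0 // => x /negbTE->. Qed.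

Lemma sum_eqM (f : 'I_n -> R) u : \sum_x (x == u)%:R * f x = f u.
Proof.
by rewrite (bigD1 u) //= eqxx mul1r big1 ?addr0 // => x /negbTE->; rewrite mul0r.
Qed.

Lemma MtU1_le e A : M (e |: A) <= M A.
Proof. by apply: ler_sum => i _; exact: dtU1_le. Qed.

Lemma MtU1_ge u v A : edge u v \notin A -> M A - 2 <= M (edge u v |: A).
Proof.
move=> uvA; rewrite lerBlDr.
have -> : 2 = \sum_i ((i == u)%:R + (i == v)%:R) :> R.
  by rewrite big_split /= !sum_eq1.
rewrite -big_split; apply: ler_sum => i _ /=.
have := dtU1_ge i uvA; rewrite in_edge.
have : ((i == u) || (i == v))%:R <= (i == u)%:R + (i == v)%:R :> R.
  by case: (i == u); case: (i == v) => /=; lra.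
lra.
Qed.
End Degrees.


(** * Probabilities of a bounded number of edges *)

Section Estimates.
Variables (R : realType) (n : nat) (d : 'I_n -> nat) (D L M0 : R).
Implicit Types (A B G X : {set {set 'I_n}}) (a b c e f h i u v x y : 'I_n).
Local Notation t := (dt R d).
Local Notation M := (Mt R d).
Local Notation E := (@Esum R n d).
Local Notation N := (cnt R d).
Local Notation ind := (@edge_ind R n).
Hypothesis dD : forall i, (d i)%:R <= D.
Hypothesis D_ge : 12 <= D.
(** [L] bounds [fwd] from below in every class that is visited: [M A] stays at least [M0 - 20], and
    [fwd_ge] loses another [2 + 4 * D ^+ 2]. The next hypothesis is the source of the factor 2 in
    the crude bounds. *)
Hypothesis L_le : L + 4 * D ^+ 2 + 22 <= M0.
Hypothesis M0_le : M0 <= 2 * L.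

(* [s] further edges may be prescribed or forbidden without leaving the range of
   the estimates; D, L and M0 stay fixed while A and B grow. *)
Definition slack (s : nat) A B :=
  [/\ is_graph (A :|: B), forall i, (deg (A :|: B) i)%:R + s%:R <= D,
      M0 - 20 + 2 * s%:R <= M A & M A <= M0].

Local Notation q := (L^-1).

Lemma D2_ge : 12 * D <= D ^+ 2.
Proof. by rewrite expr2 ler_wpM2r // (le_trans _ D_ge). Qed.

Lemma L_gt0 : 0 < L.
Proof. have h := D2_ge; have := D_ge; have := L_le; have := M0_le; lra. Qed.

Lemma D_ge0 : 0 <= D. Proof. by apply: le_trans D_ge. Qed.

Lemma q_gt0 : 0 < q. Proof. by rewrite invr_gt0 L_gt0. Qed.

Lemma dt_le A i : t A i <= D.
Proof. by apply: le_trans (dD i); rewrite ler_nat leq_subr. Qed.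

Lemma slackW s s' A B : (s' <= s)%N -> slack s A B -> slack s' A B.
Proof.
move=> ss [gH hd hM1 hM2].
have ss' : s'%:R <= s%:R :> R by rewrite ler_nat.
by split=> // [i|]; [have := hd i|]; lra.
Qed.

Lemma slackU1l s u v A B : slack s.+1 A B -> u != v -> edge u v \notin A ->
  slack s (edge u v |: A) B.
Proof.
move=> [gH hd hM1 hM2] uv uvA; split.
- by rewrite -setUA is_graphU1.
- move=> i; have := hd i; have := degU1_le (edge u v) (A :|: B) i.
  rewrite -setUA -(ler_nat R) -!natr1; lra.
- by have := MtU1_ge R d uvA; move: hM1; rewrite -natr1; lra.
- exact: le_trans (MtU1_le _ _ _ _) hM2.
Qed.

Lemma slackU1r s u v A B : slack s.+1 A B -> u != v -> slack s A (edge u v |: B).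
Proof.
move=> [gH hd hM1 hM2] uv; split=> //.
- by rewrite setUCA is_graphU1.
- move=> i; have := hd i; have := degU1_le (edge u v) (A :|: B) i.
  rewrite setUCA -(ler_nat R) -!natr1; lra.
- by move: hM1; rewrite -natr1; lra.
Qed.

Lemma sum_dt2 A : \sum_x t A x ^+ 2 <= D * M A.
Proof.
rewrite mulr_sumr; apply: ler_sum => x _.
by rewrite expr2 ler_wpM2r ?dt_ge0 ?dt_le.
Qed.

Lemma qM0 : M0 * q <= 2.
Proof. by rewrite ler_pdivrMr ?L_gt0. Qed.

Lemma sum_dt_q s A B : slack s A B -> (\sum_x t A x) * q <= 2.
Proof.
case=> _ _ _ h; apply: le_trans qM0; rewrite ler_wpM2r //; exact: ltW q_gt0.
Qed.

Lemma sum_dt2_q s A B : slack s A B -> (\sum_x t A x ^+ 2) * q <= 2 * D.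
Proof.
move=> h; rewrite mulrC -(mulrC D); apply: le_trans (_ : D * (M A * q) <= _).
  by rewrite mulrC mulrA ler_wpM2r ?sum_dt2 // ltW // q_gt0.
by rewrite ler_wpM2l ?(sum_dt_q h) // D_ge0.
Qed.

(** * The two switching counts expanded *)

Lemma blk_ge0 A B u v x : 0 <= blk R A B u v x.
Proof. by rewrite /blk !addr_ge0 ?ler0n ?ind_ge0. Qed.

Lemma sum_blk s A B u v : slack s A B -> \sum_x blk R A B u v x <= D + 2 - s%:R.
Proof.
case=> gH hd _ _; rewrite !big_split /= !sum_eq1 ind_sum_graph //.
have := hd u; lra.
Qed.

(** The two factors are multiplied out. Rows of [g] sum to [t'], which decouples [x] and [y]
    everywhere except in the last double sum. *)
Lemma fwdE A B u v G : G \in cond_graphs d (edge u v |: A) B ->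
  let g := ind (G :\: (edge u v |: A)) in
  let t' := t (edge u v |: A) in
  fwd R A B u v G = M (edge u v |: A)
   - \sum_x t' x * (blk R A B u v x + g u x)
   - \sum_y t' y * (blk R A B v u y + g v y)
   + \sum_x \sum_y g x y * (blk R A B u v x + g u x) * (blk R A B v u y + g v y).
Proof.
move=> GS g t'; rewrite /fwd.
have -> : \sum_y t' y * (blk R A B v u y + g v y) =
    \sum_x \sum_y g x y * (blk R A B v u y + g v y).
  rewrite exchange_big /=; apply: eq_bigr => y _.
  rewrite -mulr_suml /t' -(ind_sum _ y GS); congr (_ * _).
  by apply: eq_bigr => x _; rewrite /g indC.
rewrite /Mt -!sumrB -big_split /=; apply: eq_bigr => x _.
rewrite /t' -(ind_sum _ x GS) mulr_suml -!sumrB -big_split /=; apply: eq_bigr => y _.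
rewrite -/(g x y) -/(g u x) -/(g v y); ring.
Qed.

(** Two forbidden sets occur because [bwd] refers to [B] as it was before uv was forbidden, while
    [G] ranges over the class in which it is. *)
Lemma bwdE A B B' u v G : G \in cond_graphs d A B' ->
  bwd R A B u v G = t A u * t A v
   - \sum_x ind (G :\: A) u x * ind (G :\: A) v x
   - \sum_x \sum_y ind (G :\: A) u x * ind (G :\: A) v y * ind (G :\: A) x y
   - \sum_x \sum_y ind (G :\: A) u x * ind (G :\: A) v y * ind (A :|: B) x y.
Proof.
move=> GS; rewrite /bwd -(ind_sum _ u GS) -(ind_sum _ v GS) mulr_suml -!sumrB.
apply: eq_bigr => x _; rewrite mulr_sumr.
have -> : ind (G :\: A) u x * ind (G :\: A) v x =
    \sum_y ind (G :\: A) u x * ((y == x)%:R * ind (G :\: A) v y).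
  by rewrite -mulr_sumr sum_eqM.
rewrite -!sumrB; apply: eq_bigr => y _; rewrite (eq_sym y); ring.
Qed.

(** The nonnegative double sum is dropped. Each linear sum is at most [D * (D + D)]: at most [D]
    vertices blocked by [blk], at most [D] free neighbours, each of residual degree at most [D]. *)
Lemma fwd_ge s A B u v G : slack s.+2 A B ->
  G \in cond_graphs d (edge u v |: A) B ->
  edge u v \notin A ->
  M A - 2 - 4 * D ^+ 2 <= fwd R A B u v G.
Proof.
move=> hst GS uvA; rewrite fwdE //.
set g := ind _; set t' := t _; have D0 := D_ge0.
have bnd w w' : \sum_x t' x * (blk R A B w w' x + g w x) <= 2 * D ^+ 2.
  apply: le_trans (_ : \sum_x D * (blk R A B w w' x + g w x) <= _).
    apply: ler_sum => x _; rewrite ler_wpM2r ?dt_le //.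
    by rewrite addr_ge0 ?blk_ge0 ?ind_ge0.
  rewrite -mulr_sumr big_split /= (ind_sum _ w GS).
  have -> : 2 * D ^+ 2 = D * (D + D) by ring.
  rewrite ler_wpM2l // lerD ?dt_le //.
  have := sum_blk w w' hst; have : 0 <= s%:R :> R by exact: ler0n.
  rewrite -addn2 natrD; lra.
have := bnd u v; have := bnd v u; have := MtU1_ge R d uvA.
have : 0 <= \sum_x \sum_y g x y * (blk R A B u v x + g u x) * (blk R A B v u y + g v y).
  apply: sumr_ge0 => x _; apply: sumr_ge0 => y _.
  by rewrite !mulr_ge0 ?addr_ge0 ?blk_ge0 ?ind_ge0.
lra.
Qed.

Lemma sum2_ge0 (f : 'I_n -> 'I_n -> R) : (forall x y, 0 <= f x y) ->
  0 <= \sum_x \sum_y f x y.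
Proof. by move=> h; apply: sumr_ge0 => x _; apply: sumr_ge0 => y _. Qed.

Lemma bwd_le A B B' u v G : G \in cond_graphs d A B' ->
  bwd R A B u v G <= t A u * t A v.
Proof.
move=> GS; rewrite (bwdE _ _ _ GS).
set a := \sum_x _; set b := \sum_x _; set c := \sum_x _.
have : 0 <= a by apply: sum2_ge0 => x y; rewrite !mulr_ge0 ?ind_ge0.
have : 0 <= b by apply: sum2_ge0 => x y; rewrite !mulr_ge0 ?ind_ge0.
have : 0 <= c by apply: sumr_ge0 => x _; rewrite mulr_ge0 ?ind_ge0.
lra.
Qed.

(** The start of the bootstrap: both switching counts are bounded graph by graph, so no edge
    probability enters. *)
Lemma cnt_edge_le s A B u v : slack s.+2 A B -> u != v -> edge u v \notin A :|: B ->
  (M A - 2 - 4 * D ^+ 2) * N (edge u v |: A) B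
    <= t A u * t A v * N A (edge u v |: B).
Proof.
move=> hst uv uvH; have [gH _ _ _] := hst.
have uvA : edge u v \notin A by move: uvH; rewrite inE negb_or => /andP[].
rewrite -!Esum_const.
apply: le_trans (_ : Esum d A (edge u v |: B) (bwd R A B u v) <= _).
  rewrite -switching //; apply: le_Esum => G GS; exact: fwd_ge hst GS uvA.
by apply: le_Esum => G GS; exact: bwd_le GS.
Qed.

Lemma cnt_edge_leL s A B u v : slack s.+2 A B -> u != v -> edge u v \notin A :|: B ->
  L * N (edge u v |: A) B <= t A u * t A v * N A (edge u v |: B).
Proof.
move=> hst uv uvH; apply: le_trans (cnt_edge_le hst uv uvH).
rewrite ler_wpM2r ?cnt_ge0 //; case: hst => _ _ h _.
have := ler0n R s.+2; have := L_le; lra.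
Qed.

Lemma cnt_edge_leq s A B u v : slack s.+2 A B -> u != v -> edge u v \notin A :|: B ->
  N (edge u v |: A) B <= t A u * t A v * q * N A B.
Proof.
move=> hst uv uvH; rewrite mulrAC ler_pdivlMr ?L_gt0 // mulrC.
apply: le_trans (cnt_edge_leL hst uv uvH) _.
by rewrite ler_wpM2l ?mulr_ge0 ?dt_ge0 ?cntU1r_le.
Qed.

(** The step that is iterated over several edges. The bound on [F] is requested only for an
    admissible pair, since otherwise the indicator vanishes on the whole class. *)
Lemma Esum_edge_le s A B a b F K : slack s.+2 A B -> 0 <= K ->
  (a != b -> edge a b \notin A :|: B ->
     E (edge a b |: A) B F <= K * N (edge a b |: A) B) ->
  E A B (fun G => ind (G :\: A) a b * F G) <= t A a * t A b * q * K * N A B.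
Proof.
move=> hst K0 h; have [gH _ _ _] := hst.
have rhs0 : 0 <= t A a * t A b * q * K * N A B.
  by rewrite !mulr_ge0 ?dt_ge0 ?cnt_ge0 // ltW // q_gt0.
have [ab|ab] := eqVneq a b.
  rewrite (@eq_Esum _ _ _ _ _ _ (fun=> 0)) ?Esum_const ?mul0r //.
  move=> G /condP[gG _ _ _].
  by rewrite ab indxx ?mul0r // (is_graph_sub (subsetDl _ _)).
have [abH|abH] := boolP (edge a b \in A :|: B).
  rewrite (@eq_Esum _ _ _ _ _ _ (fun=> 0)) ?Esum_const ?mul0r //.
  by move=> G GS; rewrite (ind_notin _ GS abH) mul0r.
have abA : edge a b \notin A by move: abH; rewrite inE negb_or => /andP[].
rewrite Esum_edge //; apply: le_trans (h ab abH) _.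
rewrite [leRHS]mulrAC [leRHS]mulrC ler_wpM2l //.
exact: cnt_edge_leq hst ab abH.
Qed.

Lemma edge1_le s A B a b : slack s.+2 A B ->
  E A B (fun G => ind (G :\: A) a b) <= t A a * t A b * q * N A B.
Proof.
move=> hst; rewrite (@eq_Esum _ _ _ _ _ _ (fun G => ind (G :\: A) a b * 1)); last first.
  by move=> G _; rewrite mulr1.
apply: le_trans (Esum_edge_le hst (ler01) _) _; last by rewrite mulr1.
by move=> _ _; rewrite Esum_const.
Qed.

(** Distinctness matters: for equal edges the product is a single indicator and yields only one
    factor [q]. *)
Lemma edge2_le s A B a b a' b' : slack s.+3 A B -> edge a b != edge a' b' ->
  E A B (fun G => ind (G :\: A) a b * ind (G :\: A) a' b')
    <= t A a * t A b * q * (t A a' * t A b' * q) * N A B.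
Proof.
move=> hst ne; apply: (Esum_edge_le (s := s.+1) hst).
  by rewrite !mulr_ge0 ?dt_ge0 // ltW // q_gt0.
move=> ab abH.
have abA : edge a b \notin A by move: abH; rewrite inE negb_or => /andP[].
rewrite (eq_Esum (F' := fun G => ind (G :\: (edge a b |: A)) a' b')); last first.
  by move=> G _; rewrite ind_U1.
apply: le_trans (edge1_le a' b' (slackU1l hst ab abA)) _.
rewrite ler_wpM2r ?cnt_ge0 // ler_wpM2r ?(ltW q_gt0) //.
by rewrite ler_pM ?dt_ge0 ?dtU1_le.
Qed.

Lemma edge3_le s A B a b a' b' a'' b'' : slack s.+4 A B -> edge a b != edge a' b' ->
  edge a b != edge a'' b'' -> edge a' b' != edge a'' b'' ->
  E A B (fun G => ind (G :\: A) a b * (ind (G :\: A) a' b' * ind (G :\: A) a'' b''))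
    <= t A a * t A b * q * (t A a' * t A b' * q * (t A a'' * t A b'' * q)) * N A B.
Proof.
have q0 := ltW q_gt0.
move=> hst ne ne1 ne2; apply: (Esum_edge_le (s := s.+2) hst).
  by rewrite !mulr_ge0 ?dt_ge0.
move=> ab abH.
have abA : edge a b \notin A by move: abH; rewrite inE negb_or => /andP[].
rewrite (eq_Esum (F' := fun G => ind (G :\: (edge a b |: A)) a' b' *
   ind (G :\: (edge a b |: A)) a'' b'')); last first.
  by move=> G _; rewrite !ind_U1.
apply: le_trans (edge2_le (slackU1l hst ab abA) ne2) _.
rewrite ler_wpM2r ?cnt_ge0 //.
by rewrite ler_pM ?mulr_ge0 ?dt_ge0 // ler_wpM2r // ler_pM ?dt_ge0 ?dtU1_le.
Qed.
Let q0 : 0 <= q. Proof. exact: ltW q_gt0. Qed.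
Let D0 : 0 <= D. Proof. exact: D_ge0. Qed.
Let L0 : 0 < L. Proof. exact: L_gt0. Qed.
Let qL : L * q = 1. Proof. by rewrite mulfV ?gt_eqF. Qed.

Let eqW (x y : R) : x = y -> x <= y. Proof. by move=> ->. Qed.

Lemma Esum_common_le s A B u v : slack s.+3 A B -> u != v ->
  E A B (fun G => \sum_x ind (G :\: A) u x * ind (G :\: A) v x)
    <= 2 * D * q * (t A u * t A v) * N A B.
Proof.
move=> hst uv; rewrite Esum_sum.
apply: le_trans (_ : \sum_x t A u * t A v * q * N A B * (t A x ^+ 2 * q) <= _).
  apply: ler_sum => x _; apply: le_trans (edge2_le hst _) _.
    by rewrite edge_eq eqxx andbT (negbTE uv) /=; apply: contraNN uv => /andP[/eqP-> /eqP->].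
  by apply: eqW; ring.
rewrite -mulr_sumr -mulr_suml.
have -> : 2 * D * q * (t A u * t A v) * N A B = t A u * t A v * q * N A B * (2 * D).
  by ring.
rewrite ler_wpM2l ?(sum_dt2_q hst) //.
by rewrite !mulr_ge0 ?dt_ge0 ?cnt_ge0.
Qed.

Lemma ind_path_ne u v x y : u != v -> x != v -> y != u ->
  [/\ edge u x != edge v y, edge u x != edge x y & edge v y != edge x y].
Proof.
move=> uv xv yu; rewrite !edge_eq (negbTE uv) (eq_sym u y) (negbTE yu) /=.
split=> //; apply/negP.
  by rewrite orbF => /andP[/eqP ux /eqP xy]; rewrite ux xy eqxx in yu.
rewrite eqxx andbT (eq_sym v) (negbTE xv) /=; move=> /andP[/eqP vy /eqP yx].
by rewrite -yx vy eqxx in xv.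
Qed.

(** Having uv already prescribed or forbidden removes the paths with [x = v] or [y = u], whose three
    edges would not be distinct. *)
Lemma Esum_path_le s A B u v : slack s.+4 A B -> u != v -> edge u v \in A :|: B ->
  E A B (fun G => \sum_x \sum_y ind (G :\: A) u x * ind (G :\: A) v y * ind (G :\: A) x y)
    <= 4 * D ^+ 2 * q * (t A u * t A v) * N A B.
Proof.
move=> hst uv uvH; rewrite Esum_sum.
apply: le_trans (_ : \sum_x t A u * t A v * q * N A B * (t A x ^+ 2 * q) *
  \sum_y (t A y ^+ 2 * q) <= _).
  apply: ler_sum => x _; rewrite Esum_sum mulr_sumr; apply: ler_sum => y _.
  have rhs0 : 0 <= t A u * t A v * q * N A B * (t A x ^+ 2 * q) * (t A y ^+ 2 * q).
    by rewrite !mulr_ge0 ?dt_ge0 ?cnt_ge0 ?exprn_ge0.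
  have [xv|xv] := eqVneq x v.
    rewrite (eq_Esum (F' := fun=> 0)) ?Esum_const ?mul0r // => G GS.
    by rewrite xv (ind_notin _ GS uvH) !mul0r.
  have [yu|yu] := eqVneq y u.
    rewrite (eq_Esum (F' := fun=> 0)) ?Esum_const ?mul0r // => G GS.
    by rewrite yu (indC _ _ v) (ind_notin _ GS uvH) mulr0 mul0r.
  have [n1 n2 n3] := ind_path_ne uv xv yu.
  under eq_Esum do rewrite -mulrA.
  apply: le_trans (edge3_le hst n1 n2 n3) _.
  by apply: eqW; ring.
rewrite -mulr_suml -mulr_sumr -!mulr_suml.
have := sum_dt2_q hst; set S := (_ * q) => SD.
have S0 : 0 <= S by rewrite mulr_ge0 ?sumr_ge0 // => x _; rewrite exprn_ge0 ?dt_ge0.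
rewrite -mulrA.
have -> : 4 * D ^+ 2 * q * (t A u * t A v) * N A B =
  t A u * t A v * q * N A B * ((2 * D) * (2 * D)) by ring.
rewrite ler_wpM2l //; last by rewrite ler_pM.
by rewrite !mulr_ge0 ?dt_ge0 ?cnt_ge0.
Qed.

(** The set [X] of chords is separate from [A :|: B] because the sum is taken where uv is forbidden,
    while the chords come from the union without uv. *)
Lemma Esum_chord_le s A B X u v : slack s.+3 A B -> u != v -> edge u v \in A :|: B ->
  (forall x, \sum_y ind X x y <= D) ->
  E A B (fun G => \sum_x \sum_y ind (G :\: A) u x * ind (G :\: A) v y * ind X x y)
    <= 2 * D ^+ 2 * q * (t A u * t A v) * N A B.
Proof.
move=> hst uv uvH hX; rewrite Esum_sum.
apply: le_trans (_ : \sum_x t A u * t A v * q * N A B * (t A x * q) *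
  \sum_y (D * ind X x y) <= _).
  apply: ler_sum => x _; rewrite Esum_sum mulr_sumr; apply: ler_sum => y _.
  have rhs0 : 0 <= t A u * t A v * q * N A B * (t A x * q) * (D * ind X x y).
    by rewrite !mulr_ge0 ?dt_ge0 ?cnt_ge0 ?ind_ge0.
  have [xv|xv] := eqVneq x v.
    rewrite (eq_Esum (F' := fun=> 0)) ?Esum_const ?mul0r // => G GS.
    by rewrite xv (ind_notin _ GS uvH) !mul0r.
  have [yu|yu] := eqVneq y u.
    rewrite (eq_Esum (F' := fun=> 0)) ?Esum_const ?mul0r // => G GS.
    by rewrite yu (indC _ _ v) (ind_notin _ GS uvH) mulr0 mul0r.
  have [n1 _ _] := ind_path_ne uv xv yu.
  under eq_Esum do rewrite mulrC.
  rewrite EsumZ.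
  apply: le_trans (ler_wpM2l (ind_ge0 _ _ _ _) (edge2_le hst n1)) _.
  have -> : ind X x y * (t A u * t A x * q * (t A v * t A y * q) * N A B) =
   t A u * t A v * q * N A B * (t A x * q) * (t A y * ind X x y) by ring.
  rewrite ler_wpM2l ?ler_wpM2r ?ind_ge0 ?(dt_le) //.
  by rewrite !mulr_ge0 ?dt_ge0 ?cnt_ge0.
apply: le_trans (_ : \sum_x t A u * t A v * q * N A B * (t A x * q) * (D * D) <= _).
  apply: ler_sum => x _; rewrite -mulr_sumr ler_wpM2l ?ler_wpM2l ?hX //.
  by rewrite !mulr_ge0 ?dt_ge0 ?cnt_ge0.
rewrite -mulr_suml -mulr_sumr -!mulr_suml.
have -> : 2 * D ^+ 2 * q * (t A u * t A v) * N A B =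
  t A u * t A v * q * N A B * 2 * (D * D) by ring.
rewrite ler_wpM2r ?mulr_ge0 // ler_wpM2l ?(sum_dt_q hst) //.
by rewrite !mulr_ge0 ?dt_ge0 ?cnt_ge0.
Qed.

(** * Two-sided estimates for up to three edges *)

Lemma ind_blk_le1 A B u v x G : G \in cond_graphs d (edge u v |: A) B ->
  is_graph (A :|: B) -> u != v -> edge u v \notin A :|: B ->
  0 <= 1 - blk R A B u v x - ind (G :\: (edge u v |: A)) u x <= 1.
Proof.
move=> GS gH uv uvH.
have [xuv|] := boolP (x \in [:: u; v]); first by rewrite (blk0 _ GS) // lexx ler01.
rewrite !inE negb_or => /andP[xu xv].
have -> : blk R A B u v x = ind ((edge u v |: A) :|: B) u x.
  rewrite /blk (negbTE xu) (negbTE xv) !add0r /edge_ind -setUA [in RHS]in_setU1.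
  by rewrite edge_eq eqxx (negbTE xv) (negbTE xu) !andbF.
by rewrite (ind_compl R u x GS) ler0n lern1 leq_b1.
Qed.

Lemma fwd_le A B u v G : G \in cond_graphs d (edge u v |: A) B ->
  is_graph (A :|: B) -> u != v -> edge u v \notin A :|: B ->
  fwd R A B u v G <= M (edge u v |: A).
Proof.
move=> GS gH uv uvH; rewrite /fwd /Mt; apply: ler_sum => x _.
rewrite -(ind_sum R x GS); apply: ler_sum => y _.
have /andP[h1 h2] := ind_blk_le1 x GS gH uv uvH.
have /andP[h3 h4] : 0 <= 1 - blk R A B v u y - ind (G :\: (edge u v |: A)) v y <= 1.
  have := @ind_blk_le1 A B v u y G; rewrite (edgeC v u); apply => //.
  by rewrite eq_sym.
rewrite -mulrA ler_piMr ?ind_ge0 //.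
by rewrite -[leRHS]mulr1 ler_pM.
Qed.

Lemma sum_ind_slack s A B x : slack s A B -> \sum_y ind (A :|: B) x y <= D.
Proof.
move=> [gH h _ _]; rewrite ind_sum_graph //; have := h x; have := ler0n R s; lra.
Qed.

(** The upper half is the crude bound before [M A] is weakened to [L]. The lower half compares
    [fwd <= M0] with the average of [bwd], whose corrections are now controlled by the crude
    probabilities. *)
Lemma cnt_near1 s A B a b : slack s.+1.+4 A B -> a != b -> edge a b \notin A :|: B ->
  `|M0 * N (edge a b |: A) B - t A a * t A b * N A B|
    <= 9 * (D ^+ 2 * q) * (t A a * t A b * N A B).
Proof.
move=> hst ab abH; have [gH hdeg hM1 hM2] := hst.
have hst' : slack s.+4 A (edge a b |: B) by exact: slackU1r hst ab.
set N1 := N _ B; set T := t A a * t A b; set N0 := N A B.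
have T0 : 0 <= T by rewrite mulr_ge0 ?dt_ge0.
have N00 : 0 <= N0 by exact: cnt_ge0.
have NE : N0 = N1 + N A (edge a b |: B) by exact: cntD.
have N1q : N1 <= T * q * N0 := cnt_edge_leq hst ab abH.
have N10 : 0 <= N1 by exact: cnt_ge0.
have TD : T <= D ^+ 2 by rewrite expr2 ler_pM ?dt_ge0 ?(dt_le).
have D2 := D2_ge.
have up := cnt_edge_le hst ab abH.
have abH' : edge a b \in A :|: (edge a b |: B) by rewrite !inE eqxx orbT.
(* Common neighbours cost 2, with [D] relaxed to [D ^+ 2], paths 4 and chords 2, which makes 8. The
   ninth unit is the difference between [N0] and the class avoiding ab. *)
have lo : T * N A (edge a b |: B) * (1 - 8 * (D ^+ 2 * q)) <= M0 * N1.
  apply: le_trans (_ : E A (edge a b |: B) (bwd R A B a b) <= _); last first.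
    rewrite -switching // -Esum_const; apply: le_Esum => G GS.
    by apply: le_trans (fwd_le GS gH ab abH) _; apply: le_trans (MtU1_le _ _ _ _) hM2.
  rewrite (eq_Esum (fun G GS => bwdE B a b GS)).
  rewrite !(EsumD, EsumN) Esum_const.
  have hX x := sum_ind_slack x hst.
  have := Esum_common_le hst' ab; have := Esum_path_le hst' ab abH'.
  have := Esum_chord_le hst' ab abH' hX.
  set e1 := E _ _ _; set e2 := E _ _ _; set e3 := E _ _ _.
  set N2 := N A _; rewrite -/T => h1 h2 h3.
  have TN0 : 0 <= q * T * N2 by rewrite !mulr_ge0 ?cnt_ge0.
  have : 2 * D * q * T * N2 <= 2 * D ^+ 2 * q * T * N2.
    have -> : 2 * D * q * T * N2 = 2 * D * (q * T * N2) by ring.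
    have -> : 2 * D ^+ 2 * q * T * N2 = 2 * D ^+ 2 * (q * T * N2) by ring.
    by rewrite ler_wpM2r //; have := D_ge; lra.
  lra.
have TN00 : 0 <= T * N0 by rewrite mulr_ge0.
have h1 : D ^+ 2 * N1 <= D ^+ 2 * (T * q * N0) by rewrite ler_wpM2l ?exprn_ge0.
have h2 : T * N1 <= D ^+ 2 * (T * q * N0).
  by rewrite (le_trans _ h1) // ler_wpM2r.
have h3 : T * N A (edge a b |: B) * (D ^+ 2 * q) <= T * N0 * (D ^+ 2 * q).
  by rewrite ler_wpM2r ?mulr_ge0 ?exprn_ge0 // ler_wpM2l // cntU1r_le.
have h4 : (M0 - 22 - 4 * D ^+ 2) * N1 <= T * N A (edge a b |: B).
  apply: le_trans up; rewrite ler_wpM2r //; have := ler0n R s.+1.+4; lra.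
have h5 : 22 * N1 <= D ^+ 2 * N1 by rewrite ler_wpM2r //; have := D_ge; lra.
have h6 : 0 <= D ^+ 2 * (T * q * N0) by rewrite !mulr_ge0 ?exprn_ge0.
rewrite ler_norml; apply/andP; split.
  have -> : T * N0 = T * N1 + T * N A (edge a b |: B) by rewrite NE; ring.
  have h7 : T * N0 * (D ^+ 2 * q) = D ^+ 2 * (T * q * N0) by ring.
  have h8 : 0 <= T * N1 * (D ^+ 2 * q) by rewrite !mulr_ge0 ?exprn_ge0.
  have h9 : T * N0 = T * N1 + T * N A (edge a b |: B) by rewrite NE; ring.
  have h10 : 9 * (D ^+ 2 * q) * (T * N1 + T * N A (edge a b |: B))
     = 9 * (D ^+ 2 * (T * q * N0)) by rewrite -h9; ring.
  rewrite h10; lra.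
have h7 : T * N A (edge a b |: B) <= T * N0 by rewrite ler_wpM2l // cntU1r_le.
lra.
Qed.

Let M00 : 0 < M0.
Proof. have := L0; have := L_le; have := exprn_ge0 2 D0; lra. Qed.
Let dl0 : 0 <= D ^+ 2 * q. Proof. by rewrite mulr_ge0 ?exprn_ge0. Qed.

(** Telescoping over the two edges: 27 is 9 * 2 + 9, the factor 2 being the crude bound on the first
    edge. The second conclusion is the crude bound that the three-edge estimate uses. *)
Lemma cnt_near2 s A B a b c e : slack s.+2.+4 A B ->
  a != b -> edge a b \notin A :|: B -> c != e -> edge c e \notin A :|: B ->
  edge a b != edge c e ->
  let A1 := edge a b |: A in
  let T := t A1 c * t A1 e * (t A a * t A b) in
  `|M0 ^+ 2 * N (edge c e |: A1) B - T * N A B| <= 27 * (D ^+ 2 * q) * (T * N A B) /\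
  M0 ^+ 2 * N (edge c e |: A1) B <= 4 * T * N A B.
Proof.
move=> hst ab abH ce ceH ne A1 T.
have abA : edge a b \notin A by move: abH; rewrite inE negb_or => /andP[].
have hst1 : slack s.+1.+4 A1 B by exact: slackU1l.
have ceH1 : edge c e \notin A1 :|: B.
  by rewrite -setUA in_setU1 negb_or eq_sym ne.
have n1 := cnt_near1 (slackW (leqnSn _) hst) ab abH.
have n2 := cnt_near1 hst1 ce ceH1.
have u1 := cnt_edge_leq (s := s.+4) hst ab abH.
have u2 := cnt_edge_leq (s := s.+3) hst1 ce ceH1.
rewrite -/A1 in n1 n2 u1 u2; rewrite /T.
set N2 := N (edge c e |: A1) B in n2 u2 *.
set N1 := N A1 B in n1 n2 u1 u2 *; set N0 := N A B in n1 u1 *.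
set a1 := t A a * t A b in n1 u1 *.
set a2 := t A1 c * t A1 e in n2 u2 *.
have a10 : 0 <= a1 by rewrite mulr_ge0 ?dt_ge0.
have a20 : 0 <= a2 by rewrite mulr_ge0 ?dt_ge0.
have v1 : M0 * N1 <= 2 * a1 * N0.
  apply: le_trans (ler_wpM2l (ltW M00) u1) _.
  have -> : M0 * (a1 * q * N0) = (M0 * q) * (a1 * N0) by ring.
  by rewrite -[leRHS]mulrA ler_wpM2r ?(qM0) // mulr_ge0 ?cnt_ge0.
have v2 : M0 * N2 <= 2 * a2 * N1.
  apply: le_trans (ler_wpM2l (ltW M00) u2) _.
  have -> : M0 * (a2 * q * N1) = (M0 * q) * (a2 * N1) by ring.
  by rewrite -[leRHS]mulrA ler_wpM2r ?(qM0) // mulr_ge0 ?cnt_ge0.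
have v3 : a2 * (M0 * N1) <= a2 * (2 * a1 * N0) by rewrite ler_wpM2l.
have v4 := ler_wpM2l (ltW M00) v2.
split; last by lra.
have -> : M0 ^+ 2 * N2 - a2 * a1 * N0 =
  M0 * (M0 * N2 - a2 * N1) + a2 * (M0 * N1 - a1 * N0) by ring.
apply: le_trans (ler_normD _ _) _.
rewrite (normrM M0) (normrM a2) (gtr0_norm M00) (ger0_norm a20).
apply: le_trans (lerD (ler_wpM2l (ltW M00) n2) (ler_wpM2l a20 n1)) _.
have := ler_wpM2l dl0 v3; lra.
Qed.

(** Telescoping once more: 63 is 9 * 4 + 27, with the crude factor 4 for two edges. *)
Lemma cnt_near3 s A B a b c e f h : slack s.+3.+4 A B ->
  a != b -> edge a b \notin A :|: B -> c != e -> edge c e \notin A :|: B ->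
  f != h -> edge f h \notin A :|: B ->
  edge a b != edge c e -> edge a b != edge f h -> edge c e != edge f h ->
  let A1 := edge a b |: A in
  let A2 := edge c e |: A1 in
  let T := t A2 f * t A2 h * (t A1 c * t A1 e * (t A a * t A b)) in
  is_true (`|M0 ^+ 3 * N (edge f h |: A2) B - T * N A B|
    <= 63 * (D ^+ 2 * q) * (T * N A B)).
Proof.
move=> hst ab abH ce ceH fh fhH ne ne1 ne2 A1 A2 T.
have abA : edge a b \notin A by move: abH; rewrite inE negb_or => /andP[].
have ceA1 : edge c e \notin A1.
  by move: ceH; rewrite !in_setU in_set1 !negb_or eq_sym ne => /andP[].
have hst1 : slack s.+2.+4 A1 B by exact: slackU1l.
have hst2 : slack s.+1.+4 A2 B by exact: slackU1l.
have fhH2 : edge f h \notin A2 :|: B.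
  by rewrite -!setUA !in_setU1 !negb_or eq_sym ne2 eq_sym ne1.
have [n1 u1] := cnt_near2 (slackW (leqnSn _) hst) ab abH ce ceH ne.
have n2 := cnt_near1 hst2 fh fhH2.
rewrite -/A1 -/A2 in n1 n2 u1; rewrite /T.
set N2 := N (edge f h |: A2) B in n2 *.
set N1 := N A2 B in n1 n2 u1 *; set N0 := N A B in n1 u1 *.
set a1 := t A1 c * t A1 e * _ in n1 u1 *.
set a2 := t A2 f * t A2 h in n2 *.
have a10 : 0 <= a1 by rewrite !mulr_ge0 ?dt_ge0.
have a20 : 0 <= a2 by rewrite mulr_ge0 ?dt_ge0.
have v3 : a2 * (M0 ^+ 2 * N1) <= a2 * (4 * a1 * N0) by rewrite ler_wpM2l.
have -> : M0 ^+ 3 * N2 - a2 * a1 * N0 =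
  M0 ^+ 2 * (M0 * N2 - a2 * N1) + a2 * (M0 ^+ 2 * N1 - a1 * N0) by ring.
have M20 : 0 <= M0 ^+ 2 by rewrite exprn_ge0 // ltW.
apply: le_trans (ler_normD _ _) _.
rewrite (normrM (M0 ^+ 2)) (normrM a2) (ger0_norm M20) (ger0_norm a20).
apply: le_trans (lerD (ler_wpM2l M20 n2) (ler_wpM2l a20 n1)) _.
have := ler_wpM2l dl0 v3; lra.
Qed.

(* At least 1 when ab cannot be an edge outside A of a graph of the model, and 0
   otherwise (see [forbP]). *)
Definition forb A B u x : R := (u == x)%:R + ind (A :|: B) u x.
Local Notation w A x := (t A x * (t A x - 1)).

Lemma forb_ge0 A B u x : 0 <= forb A B u x.
Proof. by rewrite addr_ge0 ?ler0n. Qed.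

Lemma sum_forb s A B u : slack s.+1 A B -> \sum_x forb A B u x <= D.
Proof.
move=> [gH hd _ _]; rewrite big_split /= ind_sum_graph //.
under eq_bigr do rewrite eq_sym; rewrite sum_eq1.
have := hd u; have := ler0n R s; rewrite -natr1; lra.
Qed.

Lemma forbP A B a b : (a != b /\ edge a b \notin A :|: B /\ forb A B a b = 0) \/
  (1 <= forb A B a b /\
   forall G, G \in cond_graphs d A B -> ind (G :\: A) a b = 0).
Proof.
have [<-|ab] := eqVneq a b.
  right; split; first by rewrite /forb eqxx lerDl ind_ge0.
  by move=> G /condP[gG _ _ _]; rewrite indxx // (is_graph_sub (subsetDl _ _)).
have [abH|abH] := boolP (edge a b \in A :|: B).
  right; split; first by rewrite /forb /edge_ind abH lerDr ler0n.
  by move=> G GS; rewrite (ind_notin _ GS abH).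
by left; rewrite /forb (negbTE ab) /edge_ind (negbTE abH) addr0.
Qed.

Lemma w_ge0 A x : 0 <= w A x.
Proof.
have [->|h] := eqVneq (t A x) 0; first by rewrite mul0r.
rewrite mulr_ge0 ?dt_ge0 // subr_ge0.
by move: h; rewrite /dt pnatr_eq0 -lt0n ler1n.
Qed.

Lemma w_leD A x : w A x <= D * t A x.
Proof.
rewrite mulrC ler_wpM2r ?dt_ge0 // lerBlDr; have := dt_le A x; lra.
Qed.

Lemma w_le A x : w A x <= D ^+ 2.
Proof.
by apply: le_trans (w_leD _ _) _; rewrite expr2 ler_wpM2l ?(dt_le).
Qed.

Lemma M2t_ge0 A : 0 <= M2t R d A.
Proof. by apply: sumr_ge0 => x _; exact: w_ge0. Qed.

Lemma M2t_le s A B : slack s A B -> M2t R d A <= D * M0.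
Proof.
move=> [_ _ _ h]; apply: le_trans (_ : D * M A <= _); last by rewrite ler_wpM2l.
by rewrite mulr_sumr; apply: ler_sum => x _; exact: w_leD.
Qed.

(** Treats inadmissible pairs, where the sum is zero although [X] is predicted. The term [b], made
    of values of [forb], pays for the whole prediction; this is cheap because [forb] sums to at most
    [D] along a row. *)
Lemma norm_bad (X c b : R) : 0 <= X -> 0 <= c -> 1 <= b ->
  `|0 - X| <= (c + b) * X.
Proof.
move=> X0 c0 b1; rewrite sub0r normrN ger0_norm //.
by rewrite -[leLHS]mul1r ler_wpM2r //; lra.
Qed.

(** * Common neighbours and short paths *)

(** The two edges share [x], so the second one meets the residual degree [t A x - 1]. *)
Lemma Esum_common_term s A B u v x : slack s.+2.+4 A B -> u != v ->
  `|M0 ^+ 2 * E A B (fun G => ind (G :\: A) u x * ind (G :\: A) v x)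
      - t A u * t A v * w A x * N A B|
    <= (27 * (D ^+ 2 * q) + (forb A B u x + forb A B v x)) * (t A u * t A v * w A x * N A B).
Proof.
move=> hst uv.
have T0 : 0 <= t A u * t A v * w A x * N A B.
  by rewrite !(w_ge0, dt_ge0, cnt_ge0, mulr_ge0).
have dl : 0 <= 27 * (D ^+ 2 * q) by rewrite mulr_ge0 ?dl0.
have := forb_ge0 A B u x; have := forb_ge0 A B v x.
have [[ux [uxH ->]]|[h0 h]] := forbP A B u x; last first.
  move=> ? ?; rewrite (eq_Esum (F' := fun=> 0)) => [|G GS]; last by rewrite h ?mul0r.
  by rewrite Esum_const mul0r mulr0 norm_bad //; lra.
have [[vx [vxH ->]]|[h0 h]] := forbP A B v x; last first.
  move=> ? ?; rewrite (eq_Esum (F' := fun=> 0)) => [|G GS]; last by rewrite h ?mulr0.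
  by rewrite Esum_const mul0r mulr0 norm_bad //; lra.
move=> _ _.
have ne : edge u x != edge v x.
  by rewrite edge_eq eqxx andbT (negbTE uv) /=; apply: contraNN uv => /andP[/eqP-> /eqP->].
have uxA : edge u x \notin A by move: uxH; rewrite inE negb_or => /andP[].
have vxA : edge v x \notin edge u x |: A.
  by move: vxH; rewrite !inE !negb_or eq_sym ne => /andP[].
have [n2 _] := cnt_near2 hst ux uxH vx vxH ne.
rewrite Esum_edge //.
rewrite (eq_Esum (F' := fun G => ind (G :\: (edge u x |: A)) v x)); last first.
  by move=> G _; rewrite ind_U1.
rewrite Esum_edge1 //.
have TE : t (edge u x |: A) v * t (edge u x |: A) x * (t A u * t A x) =
  t A u * t A v * w A x.
  have xin : x \in edge u x by rewrite in_edge eqxx orbT.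
  rewrite -(dtMU1 R d uxA xin) [t _ v]dtU1_notin ?in_edge ?negb_or 1?eq_sym ?uv //.
  ring.
by rewrite TE in n2; rewrite !addr0.
Qed.

Let dl27 : 0 <= 27 * (D ^+ 2 * q). Proof. by rewrite mulr_ge0. Qed.
Let dl63 : 0 <= 63 * (D ^+ 2 * q). Proof. by rewrite mulr_ge0. Qed.

(** The four vertices are distinct, so the two edges are disjoint and neither affects the residual
    degrees seen by the other. *)
Lemma Esum_chord_term s A B u v x y : slack s.+2.+4 A B -> u != v -> edge u v \in A :|: B ->
  x != y -> u != x -> edge u x \notin A :|: B -> v != y -> edge v y \notin A :|: B ->
  `|M0 ^+ 2 * E A B (fun G => ind (G :\: A) u x * ind (G :\: A) v y)
      - t A u * t A v * (t A x * t A y) * N A B|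
    <= 27 * (D ^+ 2 * q) * (t A u * t A v * (t A x * t A y) * N A B).
Proof.
move=> hst uv uvH xy ux uxH vy vyH.
have xv : x != v by apply: contraNneq uxH => ->.
have yu : y != u by apply: contraNneq vyH => ->; rewrite edgeC.
have [ne _ _] := ind_path_ne uv xv yu.
have uxA : edge u x \notin A by move: uxH; rewrite inE negb_or => /andP[].
have vyA : edge v y \notin edge u x |: A.
  by move: vyH; rewrite !inE !negb_or eq_sym ne => /andP[].
have [n2 _] := cnt_near2 hst ux uxH vy vyH ne.
rewrite Esum_edge //.
rewrite (eq_Esum (F' := fun G => ind (G :\: (edge u x |: A)) v y)); last first.
  by move=> G _; rewrite ind_U1.
rewrite Esum_edge1 //.
have TE : t (edge u x |: A) v * t (edge u x |: A) y * (t A u * t A x) =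
  t A u * t A v * (t A x * t A y).
  rewrite !dtU1_notin ?in_edge ?negb_or ?yu 1?(eq_sym v) ?uv ?(eq_sym y) ?xy //.
    by ring.
  by rewrite eq_sym xv.
by rewrite TE in n2.
Qed.

Lemma Esum_path_term s A B u v x y : slack s.+3.+4 A B -> u != v -> edge u v \in A :|: B ->
  `|M0 ^+ 3 * E A B (fun G => ind (G :\: A) u x * ind (G :\: A) v y * ind (G :\: A) x y)
      - t A u * t A v * (w A x * w A y) * N A B|
    <= (63 * (D ^+ 2 * q) + (forb A B u x + forb A B v y + forb A B x y)) *
       (t A u * t A v * (w A x * w A y) * N A B).
Proof.
move=> hst uv uvH.
have T0 : 0 <= t A u * t A v * (w A x * w A y) * N A B.
  by rewrite !(w_ge0, dt_ge0, cnt_ge0, mulr_ge0).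
have dl := dl63.
have := forb_ge0 A B u x; have := forb_ge0 A B v y; have := forb_ge0 A B x y.
have [[ux [uxH ->]]|[h0 h]] := forbP A B u x; last first.
  move=> ? ? ?; rewrite (eq_Esum (F' := fun=> 0)) => [|G GS]; last by rewrite h ?mul0r.
  by rewrite Esum_const mul0r mulr0 norm_bad //; lra.
have [[vy [vyH ->]]|[h0 h]] := forbP A B v y; last first.
  move=> ? ? ?; rewrite (eq_Esum (F' := fun=> 0)) => [|G GS].
    by rewrite Esum_const mul0r mulr0 norm_bad //; lra.
  by rewrite h ?mulr0 ?mul0r.
have [[xy [xyH ->]]|[h0 h]] := forbP A B x y; last first.
  move=> ? ? ?; rewrite (eq_Esum (F' := fun=> 0)) => [|G GS]; last by rewrite h ?mulr0.
  by rewrite Esum_const mul0r mulr0 norm_bad //; lra.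
move=> _ _ _.
have xv : x != v by apply: contraNneq uxH => ->.
have yu : y != u by apply: contraNneq vyH => ->; rewrite edgeC.
have [ne ne1 ne2] := ind_path_ne uv xv yu.
have uxA : edge u x \notin A by move: uxH; rewrite inE negb_or => /andP[].
have vyA : edge v y \notin edge u x |: A.
  by move: vyH; rewrite !inE !negb_or eq_sym ne => /andP[].
have xyA : edge x y \notin edge v y |: (edge u x |: A).
  by move: xyH; rewrite !inE !negb_or eq_sym ne2 eq_sym ne1 => /andP[].
have n3 := cnt_near3 hst ux uxH vy vyH xy xyH ne ne1 ne2.
cbv zeta in n3.
under eq_Esum do rewrite -mulrA.
rewrite Esum_edge //.
rewrite (eq_Esum (F' := fun G => ind (G :\: (edge u x |: A)) v y *
  ind (G :\: (edge u x |: A)) x y)); last by move=> G _; rewrite !ind_U1.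
rewrite Esum_edge //.
rewrite (eq_Esum (F' := fun G => ind (G :\: (edge v y |: (edge u x |: A))) x y)); last first.
  by move=> G _; rewrite [RHS]ind_U1.
rewrite Esum_edge1 //.
set A1 := edge u x |: A in vyA xyA n3 *; set A2 := edge v y |: A1 in xyA n3 *.
(* The middle edge is prescribed last, when both of its ends have already been used once; this
   produces the two falling factorials. *)
have TE : t A2 x * t A2 y * (t A1 v * t A1 y * (t A u * t A x)) =
  t A u * t A v * (w A x * w A y).
  have xin : x \in edge u x by rewrite in_edge eqxx orbT.
  have yin : y \in edge v y by rewrite in_edge eqxx orbT.
  have e1 : t A2 x = t A1 x by rewrite dtU1_notin // in_edge negb_or xv xy.
  have e2 : t A1 y = t A y by rewrite dtU1_notin // in_edge negb_or yu eq_sym xy.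
  have e3 : t A1 v = t A v by rewrite dtU1_notin // in_edge negb_or eq_sym uv eq_sym xv.
  have := dtMU1 R d vyA yin; have := dtMU1 R d uxA xin.
  rewrite -/A1 -/A2 e1 e2 e3 => <- <-; ring.
by rewrite TE in n3; rewrite !addr0.
Qed.

Lemma ler_norm_sum2 (f g h : 'I_n -> 'I_n -> R) :
  (forall x y, `|f x y - g x y| <= h x y) ->
  `|\sum_x \sum_y f x y - \sum_x \sum_y g x y| <= \sum_x \sum_y h x y.
Proof.
move=> H; rewrite -sumrB; apply: le_trans (ler_norm_sum _ _ _) _.
apply: ler_sum => x _; rewrite -sumrB; apply: le_trans (ler_norm_sum _ _ _) _.
by apply: ler_sum.
Qed.

Lemma sum_w A : \sum_x w A x = M2t R d A. Proof. by []. Qed.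

(** The error obtained is of order [D ^+ 3]; it is relaxed to the scale [D ^+ 4] shared with the
    other two corrections. *)
Lemma Esum_common_near s A B u v : slack s.+2.+4 A B -> u != v ->
  `|M0 ^+ 2 * E A B (fun G => \sum_x ind (G :\: A) u x * ind (G :\: A) v x)
      - t A u * t A v * M2t R d A * N A B|
    <= 29 * D ^+ 4 * (t A u * t A v * N A B).
Proof.
move=> hst uv; rewrite Esum_sum mulr_sumr.
have -> : t A u * t A v * M2t R d A * N A B = \sum_x t A u * t A v * w A x * N A B.
  by rewrite -mulr_suml -mulr_sumr.
rewrite -sumrB; apply: le_trans (ler_norm_sum _ _ _) _.
set K := t A u * t A v * N A B.
have K0 : 0 <= K by rewrite !mulr_ge0 ?dt_ge0 ?cnt_ge0.
apply: le_trans (_ : \sum_x K * (27 * (D ^+ 2 * q) * w A x +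
   (forb A B u x + forb A B v x) * D ^+ 2) <= _).
  apply: ler_sum => x _; apply: le_trans (Esum_common_term x hst uv) _.
  have -> : t A u * t A v * w A x * N A B = K * w A x by rewrite /K; ring.
  rewrite mulrCA ler_wpM2l // mulrDl lerD2l ler_wpM2l ?(w_le) //.
  by rewrite addr_ge0 ?forb_ge0.
rewrite -mulr_sumr mulrC ler_wpM2r // big_split /= -mulr_sumr -mulr_suml big_split /=.
rewrite sum_w.
have hM := M2t_le hst.
have h1 := sum_forb u hst; have h2 := sum_forb v hst.
have h3 : D ^+ 2 * q * M2t R d A <= D ^+ 2 * q * (D * (2 * L)).
  rewrite ler_wpM2l //; apply: le_trans hM _; by rewrite ler_wpM2l.
have h4 : D ^+ 2 * q * (D * (2 * L)) = 2 * D ^+ 3.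
  have -> : D ^+ 2 * q * (D * (2 * L)) = 2 * D ^+ 3 * (L * q) by ring.
  by rewrite qL mulr1.
have D2 : 0 <= D ^+ 2 by rewrite exprn_ge0.
have h5 := ler_wpM2r D2 h1; have h6 := ler_wpM2r D2 h2.
have h7 : D ^+ 3 * 12 <= D ^+ 3 * D by rewrite ler_wpM2l ?exprn_ge0.
have h8 : 0 <= D ^+ 3 by rewrite exprn_ge0.
lra.
Qed.

Lemma Esum_path_near s A B u v : slack s.+3.+4 A B -> u != v -> edge u v \in A :|: B ->
  `|M0 ^+ 3 * E A B (fun G => \sum_x \sum_y
        ind (G :\: A) u x * ind (G :\: A) v y * ind (G :\: A) x y)
      - t A u * t A v * M2t R d A ^+ 2 * N A B|
    <= 129 * (D ^+ 4 * M0) * (t A u * t A v * N A B).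
Proof.
move=> hst uv uvH; rewrite Esum_sum mulr_sumr.
set K := t A u * t A v * N A B.
have K0 : 0 <= K by rewrite !mulr_ge0 ?dt_ge0 ?cnt_ge0.
have -> : t A u * t A v * M2t R d A ^+ 2 * N A B =
    \sum_x \sum_y K * (w A x * w A y).
  under [RHS]eq_bigr do rewrite -mulr_sumr -mulr_sumr sum_w.
  by rewrite -mulr_sumr -mulr_suml sum_w /K; ring.
under eq_bigr do rewrite Esum_sum mulr_sumr.
apply: le_trans (@ler_norm_sum2 _ _ (fun x y => K *
  ((63 * (D ^+ 2 * q)) * (w A x * w A y) + ((forb A B u x * D ^+ 2) * w A y +
    w A x * (forb A B v y * D ^+ 2) + (D ^+ 2 * w A x) * forb A B x y))) _) _.
  move=> x y; have := Esum_path_term x y hst uv uvH.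
  have -> : t A u * t A v * (w A x * w A y) * N A B = K * (w A x * w A y).
    by rewrite /K; ring.
  move=> h; apply: le_trans h _.
  rewrite mulrCA ler_wpM2l // mulrDl lerD2l.
  have wx := w_le A x; have wy := w_le A y.
  have wx0 := w_ge0 A x; have wy0 := w_ge0 A y.
  have kx := forb_ge0 A B u x; have ky := forb_ge0 A B v y; have kxy := forb_ge0 A B x y.
  have h1 : forb A B u x * (w A x * w A y) <= forb A B u x * (D ^+ 2 * w A y).
    by rewrite ler_wpM2l // ler_wpM2r.
  have h2 : forb A B v y * (w A x * w A y) <= forb A B v y * (w A x * D ^+ 2).
    by rewrite ler_wpM2l // ler_wpM2l.
  have h3 : forb A B x y * (w A x * w A y) <= forb A B x y * (w A x * D ^+ 2).
    by rewrite ler_wpM2l // ler_wpM2l.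
  lra.
have hk x := sum_forb x hst.
have hM := M2t_le hst; have hM0 := M2t_ge0 A.
under eq_bigr do rewrite -mulr_sumr !big_split /= -!mulr_sumr -!mulr_suml sum_w.
rewrite -mulr_sumr mulrC ler_wpM2r // !big_split /= -!mulr_sumr -!mulr_suml sum_w.
set M2 := M2t R d A.
(* One factor [M2] is bounded by [2 * D * L] to cancel [q], giving 126; the three [forb] sums add 1
   each, hence 129. *)
have h1 : 63 * (D ^+ 2 * q) * (M2 * M2) <= 63 * (D ^+ 2 * q) * ((D * (2 * L)) * (D * M0)).
  rewrite ler_wpM2l // ler_pM //; apply: le_trans hM _; by rewrite ler_wpM2l.
have h2 : 63 * (D ^+ 2 * q) * ((D * (2 * L)) * (D * M0)) = 126 * (D ^+ 4 * M0).
  have -> : 63 * (D ^+ 2 * q) * ((D * (2 * L)) * (D * M0)) =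
    126 * (D ^+ 4 * M0) * (L * q) by ring.
  by rewrite qL mulr1.
have DD : 0 <= D ^+ 2 by rewrite exprn_ge0.
have s0 a : 0 <= \sum_x forb A B a x by apply: sumr_ge0 => x _; exact: forb_ge0.
have h3 : (\sum_x forb A B u x) * D ^+ 2 * M2 <= D * D ^+ 2 * (D * M0).
  by apply: ler_pM => //; [rewrite mulr_ge0 ?s0 | rewrite ler_wpM2r].
have h4 : M2 * ((\sum_x forb A B v x) * D ^+ 2) <= (D * M0) * (D * D ^+ 2).
  by apply: ler_pM => //; [rewrite mulr_ge0 ?s0 | rewrite ler_wpM2r].
have h5 : \sum_x D ^+ 2 * w A x * (\sum_y forb A B x y) <= D ^+ 2 * M2 * D.
  rewrite /M2 -sum_w mulr_sumr mulr_suml; apply: ler_sum => x _.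
  by apply: ler_wpM2l; [rewrite mulr_ge0 ?w_ge0 | exact: hk].
have h6 : D ^+ 2 * M2 * D <= D ^+ 2 * (D * M0) * D by rewrite ler_wpM2r // ler_wpM2l.
have kE : \sum_x forb A B v x = \sum_x (v == x)%:R + \sum_x ind (A :|: B) v x.
  by rewrite -big_split.
rewrite kE in h4; lra.
Qed.


(** With uv in [A :|: B], the conditions in [W] also force [x != v] and [y != u]. The bound on the
    weight of [W] shows that its correction is again O(D^2 / M). *)
Lemma Esum_chord_near s A B X u v : slack s.+2.+4 A B -> u != v -> edge u v \in A :|: B ->
  is_graph X -> (forall x, \sum_y ind X x y <= D) ->
  let W x y := [&& edge x y \in X, u != x, edge u x \notin A :|: B,
                   v != y & edge v y \notin A :|: B] in
  `|M0 ^+ 2 * E A B (fun G => \sum_x \sum_y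
        ind (G :\: A) u x * ind (G :\: A) v y * ind X x y)
      - t A u * t A v * (\sum_x \sum_y (W x y)%:R * (t A x * t A y)) * N A B|
    <= 54 * D ^+ 4 * (t A u * t A v * N A B) /\
  0 <= \sum_x \sum_y (W x y)%:R * (t A x * t A y) <= D ^+ 2 * M0.
Proof.
move=> hst uv uvH gX hX W.
set K := t A u * t A v * N A B.
have K0 : 0 <= K by rewrite !mulr_ge0 ?dt_ge0 ?cnt_ge0.
have hS : \sum_x \sum_y ind X x y * (t A x * t A y) <= D ^+ 2 * M0.
  apply: le_trans (_ : \sum_x D ^+ 2 * t A x <= _); last first.
    by rewrite -mulr_sumr ler_wpM2l ?exprn_ge0 //; case: hst.
  apply: ler_sum => x _; apply: le_trans (_ : \sum_y D * t A x * ind X x y <= _).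
    apply: ler_sum => y _; have -> : ind X x y * (t A x * t A y) = t A y * (t A x * ind X x y).
      by ring.
    rewrite -mulrA ler_wpM2r ?(dt_le) //.
    by rewrite mulr_ge0 ?dt_ge0 ?ind_ge0.
  rewrite -mulr_sumr.
  have -> : D ^+ 2 * t A x = D * t A x * D by ring.
  by rewrite ler_wpM2l ?mulr_ge0 ?dt_ge0.
split; last first.
  apply/andP; split; first by apply: sum2_ge0 => x y /=; rewrite !mulr_ge0 ?dt_ge0 ?ler0n.
  apply: le_trans hS; apply: ler_sum => x _; apply: ler_sum => y _.
  rewrite ler_wpM2r ?mulr_ge0 ?dt_ge0 // ler_nat /W.
  by case: (edge x y \in X) => //=; exact: leq_b1.
rewrite Esum_sum mulr_sumr.
have -> : t A u * t A v * (\sum_x \sum_y (W x y)%:R * (t A x * t A y)) * N A B =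
    \sum_x \sum_y K * ((W x y)%:R * (t A x * t A y)).
  under [RHS]eq_bigr do rewrite -mulr_sumr.
  by rewrite -mulr_sumr /K; ring.
under eq_bigr do rewrite Esum_sum mulr_sumr.
apply: le_trans (@ler_norm_sum2 _ _ (fun x y => K *
  ((27 * (D ^+ 2 * q)) * (ind X x y * (t A x * t A y)))) _) _.
  move=> x y.
  have [xyX|xyX] := boolP (edge x y \in X); last first.
    rewrite /W (negbTE xyX) /= mul0r mulr0.
    rewrite (eq_Esum (F' := fun=> 0)) => [|G GS].
      by rewrite Esum_const !(mul0r, mulr0) subr0 normr0 /edge_ind (negbTE xyX) mul0r !mulr0.
    by rewrite /edge_ind (negbTE xyX) mulr0.
  have ixy : ind X x y = 1 by rewrite /edge_ind xyX.
  under eq_Esum do rewrite ixy mulr1.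
  have T0 : 0 <= K * (27 * (D ^+ 2 * q) * (ind X x y * (t A x * t A y))).
    by rewrite mulr_ge0 // mulr_ge0 // !mulr_ge0 ?dt_ge0 ?ind_ge0.
  have [[ux [uxH _]]|[h0 h]] := forbP A B u x; last first.
    have -> : W x y = false.
      move: h0; rewrite /W /forb /edge_ind; case: (u == x); case: (_ \in _);
      by rewrite ?andbF //= addr0 ler10.
    rewrite (eq_Esum (F' := fun=> 0)) => [|G GS]; last by rewrite h ?mul0r.
    by rewrite Esum_const /= !(mul0r, mulr0) subr0 normr0.
  have [[vy [vyH _]]|[h0 h]] := forbP A B v y; last first.
    have -> : W x y = false.
      move: h0; rewrite /W /forb /edge_ind; case: (v == y); case: (edge v y \in _);
      by rewrite ?andbF //= addr0 ler10.
    rewrite (eq_Esum (F' := fun=> 0)) => [|G GS]; last by rewrite h ?mulr0.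
    by rewrite Esum_const /= !(mul0r, mulr0) subr0 normr0.
  have xy : x != y.
    by apply: contraNneq (edgexx_notin x gX) => {2}->.
  have := Esum_chord_term hst uv uvH xy ux uxH vy vyH.
  rewrite /W xyX ux uxH vy vyH ixy /= !mul1r.
  have -> : t A u * t A v * (t A x * t A y) * N A B = K * (t A x * t A y).
    by rewrite /K; ring.
  by move=> h; apply: le_trans h _; apply: eqW; ring.
under eq_bigr do rewrite -mulr_sumr -mulr_sumr.
rewrite -!mulr_sumr mulrC ler_wpM2r //.
apply: le_trans (ler_wpM2l dl27 hS) _.
have h3 : D ^+ 4 * q * M0 <= D ^+ 4 * q * (2 * L).
  by rewrite ler_wpM2l // mulr_ge0 ?exprn_ge0.
have h4 : D ^+ 4 * q * (2 * L) = 2 * D ^+ 4.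
  have -> : D ^+ 4 * q * (2 * L) = 2 * D ^+ 4 * (L * q) by ring.
  by rewrite qL mulr1.
lra.
Qed.

(** The constant 212 is 29 + 129 + 54, from common neighbours, paths and chords, once all are scaled
    by [M0 ^+ 3]. *)
Lemma bwd_near s A B u v : slack s.+4.+4 A B -> u != v -> edge u v \notin A :|: B ->
  let B' := edge u v |: B in
  let W2 := \sum_x \sum_y ([&& edge x y \in A :|: B, u != x, edge u x \notin A :|: B',
                   v != y & edge v y \notin A :|: B'])%:R * (t A x * t A y) in
  let K := t A u * t A v * N A B' in
  `|M0 ^+ 3 * E A B' (bwd R A B u v) -
     K * (M0 ^+ 3 - M2t R d A ^+ 2 - M2t R d A * M0 - W2 * M0)|
    <= 212 * (D ^+ 4 * M0) * K /\ 0 <= W2 <= D ^+ 2 * M0.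
Proof.
move=> hst uv uvH B' W2 K; have [gH _ _ _] := hst.
have hst' : slack s.+3.+4 A B' by exact: slackU1r.
have uvH' : edge u v \in A :|: B' by rewrite !inE eqxx orbT.
have [h3 hW] := Esum_chord_near hst' uv uvH' gH (fun x => sum_ind_slack x hst).
split; last exact: hW.
have h1 := Esum_common_near hst' uv.
have h2 := Esum_path_near hst' uv uvH'.
rewrite -/W2 in h3.
rewrite (eq_Esum (fun G GS => bwdE B u v GS)).
rewrite !(EsumD, EsumN) Esum_const -/K.
move: h1 h2 h3; set e1 := E _ _ _; set e2 := E _ _ _; set e3 := E _ _ _.
set M2 := M2t R d A; set N2 := N A B'.
have -> : t A u * t A v * M2 * N2 = K * M2 by rewrite /K; ring.
have -> : t A u * t A v * M2 ^+ 2 * N2 = K * M2 ^+ 2 by rewrite /K; ring.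
have -> : t A u * t A v * W2 * N2 = K * W2 by rewrite /K; ring.
rewrite -/K => h1 h2 h3.
have -> : M0 ^+ 3 * (K - e1 - e2 - e3) - K * (M0 ^+ 3 - M2 ^+ 2 - M2 * M0 - W2 * M0) =
  - (M0 * (M0 ^+ 2 * e1 - K * M2)) - (M0 ^+ 3 * e2 - K * M2 ^+ 2) -
  M0 * (M0 ^+ 2 * e3 - K * W2) by ring.
apply: le_trans (ler_normB _ _) _.
apply: le_trans (lerD (ler_normB _ _) (lexx _)) _.
rewrite normrN (normrM M0 (_ - K * M2)) (normrM M0 (_ - K * W2)) (gtr0_norm M00).
apply: le_trans (lerD (lerD (ler_wpM2l (ltW M00) h1) h2) (ler_wpM2l (ltW M00) h3)) _.
by apply: eqW; ring.
Qed.

(** * The mean of the forward count *)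

Let dl9 : 0 <= 9 * (D ^+ 2 * q). Proof. by rewrite mulr_ge0. Qed.

Lemma dtU1E A u v x : u != v -> edge u v \notin A -> 0 < t A u -> 0 < t A v ->
  t (edge u v |: A) x = t A x - (x == u)%:R - (x == v)%:R.
Proof.
move=> uv uvA tu tv.
have [->|xu] := eqVneq x u.
  by rewrite dtU1_in ?in_edge ?eqxx // (negbTE uv) subr0.
have [->|xv] := eqVneq x v; first by rewrite dtU1_in ?in_edge ?eqxx ?orbT // subr0.
by rewrite dtU1_notin ?in_edge ?(negbTE xu) ?(negbTE xv) // !subr0.
Qed.

Lemma MtU1E A u v : u != v -> edge u v \notin A -> 0 < t A u -> 0 < t A v ->
  M (edge u v |: A) = M A - 2.
Proof.
move=> uv uvA tu tv; rewrite /Mt (eq_bigr _ (fun x _ => dtU1E x uv uvA tu tv)).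
by rewrite !sumrB !sum_eq1; ring.
Qed.

Lemma sum_dt2E A : \sum_x t A x ^+ 2 = M2t R d A + M A.
Proof. by rewrite /Mt -big_split; apply: eq_bigr => x _ /=; ring. Qed.

Lemma sum_dt2U1E A u v : u != v -> edge u v \notin A -> 0 < t A u -> 0 < t A v ->
  \sum_x t (edge u v |: A) x ^+ 2 = M2t R d A + M A - (2 * (t A u + t A v) - 2).
Proof.
move=> uv uvA tu tv; rewrite -sum_dt2E.
have -> : 2 * (t A u + t A v) - 2 = \sum_x ((x == u)%:R * (2 * t A x - 1) +
   (x == v)%:R * (2 * t A x - 1)).
  by rewrite big_split /= !sum_eqM; ring.
rewrite -sumrB; apply: eq_bigr => x _; rewrite dtU1E //.
have [->|xu] := eqVneq x u; first by rewrite (negbTE uv) /=; ring.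
by have [->|xv] := eqVneq x v => /=; ring.
Qed.

Lemma ind_sq X x y : ind X x y * ind X x y = ind X x y.
Proof. by rewrite /edge_ind; case: (_ \in X); rewrite ?mulr1 ?mulr0. Qed.

(** The residual weight at the free neighbours of [u]. Neighbours are chosen in proportion to
    residual degree, hence the sum of squares, which is the origin of the term with [M2t] in
    [phibar]. *)
Lemma Esum_nbr_near s A B u : slack s.+1.+4 A B ->
  `|M0 * (\sum_x t A x * E A B (fun G => ind (G :\: A) u x))
     - t A u * (\sum_x t A x ^+ 2) * N A B| <= 19 * D ^+ 4 * N A B.
Proof.
move=> hst; set N1 := N A B; have N10 : 0 <= N1 by exact: cnt_ge0.
have -> : t A u * (\sum_x t A x ^+ 2) * N1 = \sum_x t A x * (t A u * t A x * N1).
  by rewrite mulr_sumr mulr_suml; apply: eq_bigr => x _; ring.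
rewrite mulr_sumr -sumrB; apply: le_trans (ler_norm_sum _ _ _) _.
apply: le_trans (_ : \sum_x (D * N1) *
  (9 * (D ^+ 2 * q) * t A x ^+ 2 + forb A B u x * D ^+ 2) <= _).
  apply: ler_sum => x _.
  set e := E _ _ _.
  have -> : M0 * (t A x * e) - t A x * (t A u * t A x * N1) =
    t A x * (M0 * e - t A u * t A x * N1) by ring.
  rewrite normrM (ger0_norm (dt_ge0 _ _ _ _)).
  have T0 : 0 <= t A u * t A x * N1 by rewrite !mulr_ge0 ?dt_ge0.
  have h : `|M0 * e - t A u * t A x * N1| <=
      (9 * (D ^+ 2 * q) + forb A B u x) * (t A u * t A x * N1).
    rewrite /e; have [[ux [uxH ->]]|[h0 h]] := forbP A B u x; last first.
      rewrite (eq_Esum (F' := fun=> 0)) => [|G GS]; last by rewrite h.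
      by rewrite Esum_const mul0r mulr0 norm_bad.
    have uxA : edge u x \notin A by move: uxH; rewrite inE negb_or => /andP[].
    rewrite Esum_edge1 // addr0. 
    have h := cnt_near1 hst ux uxH; exact: h.
  apply: le_trans (ler_wpM2l (dt_ge0 _ _ _ _) h) _.
  have -> : t A x * ((9 * (D ^+ 2 * q) + forb A B u x) * (t A u * t A x * N1)) =
    (t A u * N1) * (9 * (D ^+ 2 * q) * t A x ^+ 2 + forb A B u x * t A x ^+ 2) by ring.
  have kx := forb_ge0 A B u x.
  have h2 : t A x ^+ 2 <= D ^+ 2 by rewrite lerXn2r ?nnegrE ?dt_ge0 ?(dt_le).
  apply: ler_pM.
  - by rewrite mulr_ge0 ?dt_ge0.
  - by rewrite addr_ge0 // mulr_ge0 ?exprn_ge0 ?dt_ge0.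
  - by rewrite ler_wpM2r ?(dt_le).
  - by rewrite lerD2l ler_wpM2l.
rewrite -mulr_sumr big_split /= -mulr_sumr -mulr_suml.
have h1 := sum_forb u hst.
have hq := sum_dt2_q hst.
have h2 : D ^+ 2 * (q * (\sum_x t A x ^+ 2)) <= D ^+ 2 * (2 * D).
  by rewrite ler_wpM2l ?exprn_ge0 // mulrC.
have h3 : (\sum_x forb A B u x) * D ^+ 2 <= D * D ^+ 2 by rewrite ler_wpM2r ?exprn_ge0.
have h4 : 9 * (D ^+ 2 * q) * (\sum_x t A x ^+ 2) + (\sum_x forb A B u x) * D ^+ 2 <= 19 * D ^+ 3.
  move: h2 h3; set S := \sum_x t A x ^+ 2; set S' := \sum_x forb A B u x => h2 h3.
  lra.
apply: le_trans (ler_wpM2l (mulr_ge0 D0 N10) h4) _; apply: eqW; ring.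
Qed.

(* The terms x = v and y = u, in which two of the three edges coincide, give the
   main term. *)
Lemma Esum_overlap_near s A B u v (a b : 'I_n -> R) : slack s.+4 A B -> u != v ->
  edge u v \in A :|: B ->
  (forall x, 0 <= a x) -> (forall x, 0 <= b x) -> a v = 1 -> b u = 1 ->
  \sum_x a x <= D -> \sum_x b x <= D ->
  0 <= E A B (fun G => \sum_x \sum_y ind (G :\: A) x y *
    (a x + ind (G :\: A) u x) * (b y + ind (G :\: A) v y))
    - (t A u + t A v) * N A B <= 9 * D ^+ 4 * q * N A B.
Proof.
move=> hst uv uvH a0 b0 av bu sa sb.
set N1 := N A B; have N10 : 0 <= N1 by exact: cnt_ge0.
(* Negligible terms, sorted by whether [x] and [y] are blocked through [a] and [b] or through a free
   edge at [u] or [v]. They cost 1, 2, 2 and 4, in total 9. *)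
pose p1 G := \sum_x \sum_y a x * b y * ind (G :\: A) x y.
pose p2 G := \sum_x (x != v)%:R * a x * \sum_y ind (G :\: A) x y * ind (G :\: A) v y.
pose p3 G := \sum_y (y != u)%:R * b y * \sum_x ind (G :\: A) y x * ind (G :\: A) u x.
pose p4 G := \sum_x \sum_y ind (G :\: A) u x * ind (G :\: A) v y * ind (G :\: A) x y.
have split4 G : G \in cond_graphs d A B -> \sum_x \sum_y ind (G :\: A) x y *
    (a x + ind (G :\: A) u x) * (b y + ind (G :\: A) v y) =
    (t A u + t A v) + (p1 G + p2 G + p3 G + p4 G).
  move=> GS; set g := ind (G :\: A).
  have e2 : \sum_x \sum_y g x y * a x * g v y = t A v + p2 G.
    rewrite (bigD1 v) //= [in RHS]/p2 [in RHS](bigD1 v) //= eqxx !mul0r add0r.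
    congr (_ + _).
      under eq_bigr do rewrite av mulr1 ind_sq.
      exact: ind_sum GS.
    apply: eq_bigr => x ->; rewrite mul1r mulr_sumr; apply: eq_bigr => y _.
    by rewrite -/g; ring.
  have e3 : \sum_x \sum_y g x y * g u x * b y = t A u + p3 G.
    rewrite exchange_big /= (bigD1 u) //= [in RHS]/p3 [in RHS](bigD1 u) //= eqxx !mul0r add0r.
    congr (_ + _).
      under eq_bigr do rewrite bu mulr1 /g indC ind_sq.
      exact: ind_sum GS.
    apply: eq_bigr => x ->; rewrite mul1r mulr_sumr; apply: eq_bigr => y _.
    by rewrite -/g [g y x]indC -/g; ring.
  have -> : t A u + t A v + (p1 G + p2 G + p3 G + p4 G) =
    p1 G + (t A v + p2 G) + (t A u + p3 G) + p4 G by ring.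
  rewrite -e2 -e3 -!big_split /=; apply: eq_bigr => x _.
  rewrite -!big_split /=; apply: eq_bigr => y _; rewrite -/g; ring.
rewrite (eq_Esum split4) !EsumD !Esum_const -/N1.
have -> : t A u * N1 + t A v * N1 + (E A B p1 + E A B p2 + E A B p3 + E A B p4) -
  (t A u + t A v) * N1 = E A B p1 + E A B p2 + E A B p3 + E A B p4 by ring.
have h1 : 0 <= E A B p1 <= D ^+ 4 * q * N1.
  apply/andP; split.
    apply: Esum_ge0 => G _; apply: sum2_ge0 => x y /=; by rewrite !mulr_ge0 ?ind_ge0.
  rewrite /p1 Esum_sum.
  apply: le_trans (_ : \sum_x \sum_y a x * (b y * (D ^+ 2 * q * N1)) <= _).
    apply: ler_sum => x _; rewrite Esum_sum; apply: ler_sum => y _.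
    rewrite EsumZ -mulrA ler_wpM2l // ler_wpM2l //.
    apply: le_trans (edge1_le (s := s.+2) x y hst) _.
    by rewrite !ler_wpM2r // expr2 ler_pM ?dt_ge0 ?(dt_le).
  under eq_bigr do rewrite -mulr_sumr -mulr_suml.
  rewrite -mulr_suml.
  have -> : D ^+ 4 * q * N1 = D * (D * (D ^+ 2 * q * N1)) by ring.
  have c0 : 0 <= D ^+ 2 * q * N1 by rewrite mulr_ge0.
  by rewrite ler_pM ?mulr_ge0 ?sumr_ge0 // ler_wpM2r.
have h23 c (f : 'I_n -> R) : (forall x, 0 <= f x) -> f c = 0 -> \sum_x f x <= D ->
   0 <= E A B (fun G => \sum_x f x * \sum_y ind (G :\: A) x y * ind (G :\: A) c y)
   <= 2 * D ^+ 4 * q * N1.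
  move=> f0 fc sf; apply/andP; split.
    apply: Esum_ge0 => G _; apply: sumr_ge0 => x _; rewrite mulr_ge0 // sumr_ge0 // => y _.
    by rewrite mulr_ge0 ?ind_ge0.
  rewrite Esum_sum.
  apply: le_trans (_ : \sum_x f x * (2 * D ^+ 3 * q * N1) <= _); last first.
    rewrite -mulr_suml; have -> : 2 * D ^+ 4 * q * N1 = D * (2 * D ^+ 3 * q * N1) by ring.
    by rewrite ler_wpM2r // !mulr_ge0 ?exprn_ge0.
  apply: ler_sum => x _; rewrite EsumZ.
  have [->|xc] := eqVneq x c; first by rewrite fc !mul0r.
  rewrite ler_wpM2l // Esum_sum.
  apply: le_trans (_ : \sum_y D * D * q * N1 * (t A y ^+ 2 * q) <= _).
    apply: ler_sum => y _.
    apply: le_trans (edge2_le (s := s.+1) hst _) _.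
      rewrite edge_eq eqxx andbT (negbTE xc) /=.
      by apply: contraNN xc => /andP[/eqP-> /eqP->].
    have -> : t A x * t A y * q * (t A c * t A y * q) * N1 =
      t A x * t A c * q * N1 * (t A y ^+ 2 * q) by ring.
    rewrite ler_wpM2r ?mulr_ge0 ?exprn_ge0 ?dt_ge0 // !ler_wpM2r //.
    by rewrite ler_pM ?dt_ge0 ?(dt_le).
  rewrite -mulr_sumr -mulr_suml.
  have -> : 2 * D ^+ 3 * q * N1 = D * D * q * N1 * (2 * D) by ring.
  by rewrite ler_wpM2l ?(sum_dt2_q hst) // !mulr_ge0.
have neg1 (P : bool) (z : R) : 0 <= z -> 0 <= P%:R * z <= z.
  by case: P => z0; rewrite ?mul1r ?mul0r ?lexx ?z0.
have h2 := h23 v (fun x => (x != v)%:R * a x).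
have h3 := h23 u (fun x => (x != u)%:R * b x).
have /andP[h20 h21] : 0 <= E A B p2 <= 2 * D ^+ 4 * q * N1.
  apply: h2 => [x||]; first by case/andP: (neg1 (x != v) _ (a0 x)).
    by rewrite eqxx mul0r.
  apply: le_trans sa; apply: ler_sum => x _.
  by case/andP: (neg1 (x != v) _ (a0 x)).
have /andP[h30 h31] : 0 <= E A B p3 <= 2 * D ^+ 4 * q * N1.
  apply: h3 => [x||]; first by case/andP: (neg1 (x != u) _ (b0 x)).
    by rewrite eqxx mul0r.
  apply: le_trans sb; apply: ler_sum => x _.
  by case/andP: (neg1 (x != u) _ (b0 x)).
have h40 : 0 <= E A B p4.
  by apply: Esum_ge0 => G _; apply: sum2_ge0 => x y /=; rewrite !mulr_ge0 ?ind_ge0.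
have h41 : E A B p4 <= 4 * D ^+ 4 * q * N1.
  apply: le_trans (Esum_path_le hst uv uvH) _.
  have -> : 4 * D ^+ 4 * q * N1 = 4 * D ^+ 2 * q * (D * D) * N1 by ring.
  rewrite ler_wpM2r // ler_wpM2l ?ler_pM ?dt_ge0 ?(dt_le) //.
  by rewrite !mulr_ge0 ?exprn_ge0.
case/andP: h1 => h10 h11; apply/andP; split; last by lra.
by rewrite !addr_ge0.
Qed.

(** Prescribing uv lowers [t] only at [u] and [v], and neither is a neighbour of [u] in
    [A :|: B]. *)
Lemma blk_sum A B u v : u != v -> edge u v \notin A -> 0 < t A u -> 0 < t A v ->
  is_graph (A :|: B) -> edge u v \notin A :|: B ->
  \sum_x t (edge u v |: A) x * blk R A B u v x =
  t A u + t A v - 2 + \sum_(x in nbr (A :|: B) u) t A x.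
Proof.
move=> uv uvA tu tv gH uvH.
have -> : \sum_(x in nbr (A :|: B) u) t A x = \sum_x ind (A :|: B) u x * t A x.
  rewrite big_mkcond /=; apply: eq_bigr => x _; rewrite inE /edge_ind.
  by case: (_ \in _); rewrite ?mul1r ?mul0r.
have -> : t A u + t A v - 2 = \sum_x ((x == u)%:R * (t A x - 1) + (x == v)%:R * (t A x - 1)).
  by rewrite big_split /= !sum_eqM; ring.
rewrite -big_split; apply: eq_bigr => x _; rewrite /blk dtU1E //.
have [->|xu] := eqVneq x u; first by rewrite (negbTE uv) indxx //=; ring.
have [->|xv] := eqVneq x v; first by rewrite /edge_ind (negbTE uvH) /=; ring.
rewrite /=; ring.
Qed.

Lemma fwd_near s A B u v : slack s.+2.+4 A B -> u != v -> edge u v \notin A :|: B ->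
  0 < t A u -> 0 < t A v -> M A = M0 ->
  let S := \sum_(x in nbr (A :|: B) u) t A x + \sum_(y in nbr (A :|: B) v) t A y in
  let N1 := N (edge u v |: A) B in
  is_true (`|M0 * E (edge u v |: A) B (fwd R A B u v) -
    N1 * (M0 ^+ 2 - M0 * (2 * (t A u + t A v) - 2 + S) - (t A u + t A v - 2) * M2t R d A)|
  <= 58 * D ^+ 4 * N1).
Proof.
move=> hst uv uvH tu tv MA S N1; have [gH _ _ _] := hst.
have uvA : edge u v \notin A by move: uvH; rewrite inE negb_or => /andP[].
set A' := edge u v |: A in N1 *.
have hst' : slack s.+1.+4 A' B by exact: slackU1l.
have N10 : 0 <= N1 by exact: cnt_ge0.
have vuH : edge v u \notin A :|: B by rewrite edgeC.
have vu : v != u by rewrite eq_sym.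
have uvH' : edge u v \in A' :|: B by rewrite !inE eqxx.
have sblk a b : \sum_x blk R A B a b x <= D.
  by apply: le_trans (sum_blk a b hst) _; rewrite -!natr1; have := ler0n R s; lra.
have b1 : blk R A B u v v = 1.
  by rewrite /blk eqxx eq_sym (negbTE uv) /edge_ind (negbTE uvH) addr0 add0r.
have b2 : blk R A B v u u = 1.
  by rewrite /blk eqxx (negbTE uv) /edge_ind (negbTE vuH) addr0 add0r.
have := Esum_overlap_near (slackW (leqnSn _) hst') uv uvH'
  (blk_ge0 A B u v) (blk_ge0 A B v u) b1 b2 (sblk u v) (sblk v u).
set X := fun G => _; rewrite -/N1 => /andP[X0 X1].
have := Esum_nbr_near u hst'.
have := Esum_nbr_near v hst'.
rewrite -/N1; set eu := \sum_x t A' x * E A' B (fun G => ind (G :\: A') u x).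
set ev := \sum_x t A' x * E A' B (fun G => ind (G :\: A') v x).
rewrite sum_dt2U1E // MA => hv hu.
have bu := blk_sum uv uvA tu tv gH uvH.
have bv : \sum_x t A' x * blk R A B v u x =
    t A v + t A u - 2 + \sum_(x in nbr (A :|: B) v) t A x.
  by rewrite -(@blk_sum A B v u) // edgeC.
(* The deterministic part of [fwd]: the residual sum [M0 - 2] less the two sums evaluated by
   [blk_sum]. *)
have [c0 cE] : exists c0 : R, c0 = M0 - 2 - (2 * (t A u + t A v) - 4 + S) by eexists.
have EE : E A' B (fwd R A B u v) = c0 * N1 - eu - ev + E A' B X.
  rewrite (eq_Esum (F' := fun G => c0 + - (\sum_x t A' x * ind (G :\: A') u x)
    + - (\sum_x t A' x * ind (G :\: A') v x) + X G)).
    rewrite !EsumD !EsumN Esum_const -/N1 !Esum_sum.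
    by rewrite /eu /ev; congr (_ - _ - _ + _); apply: eq_bigr => x _; rewrite EsumZ.
  move=> G GS; rewrite (fwdE GS) /= -/A' -/(X G).
  under eq_bigr do rewrite mulrDr.
  under [in X in _ - X + _]eq_bigr do rewrite mulrDr.
  rewrite !big_split /= bu bv MtU1E // MA cE /S; ring.
have tu' : t A' u = t A u - 1 by rewrite dtU1E // eqxx (negbTE uv) subr0.
have tv' : t A' v = t A v - 1 by rewrite dtU1E // eqxx eq_sym (negbTE uv) subr0.
have ge1 x : 0 < t A x -> 1 <= t A x by rewrite /dt ltr0n ler1n.
have tu1 := ge1 _ tu; have tv1 := ge1 _ tv.
have uD := dt_le A u; have vD := dt_le A v.
rewrite tu' in hu X0 X1; rewrite tv' in hv X0 X1.
set T := t A u + t A v in hu hv cE *.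
set M2 := M2t R d A in hu hv *.
(* The overlap [T - 2] cancels against the summand [M0] of the sum of squares
   [M2 + M0 - (2 * T - 2)], so that only [(T - 2) * M2] survives at this order. The leftover product
   [(T - 2) * (2 * T - 2)] is an error term. *)
have -> : M0 * E A' B (fwd R A B u v) -
    N1 * (M0 ^+ 2 - M0 * (2 * T - 2 + S) - (T - 2) * M2) =
  - (M0 * eu - (t A u - 1) * (M2 + M0 - (2 * T - 2)) * N1)
  - (M0 * ev - (t A v - 1) * (M2 + M0 - (2 * T - 2)) * N1)
  + M0 * (E A' B X - (t A u - 1 + (t A v - 1)) * N1)
  + (T - 2) * (2 * T - 2) * N1.
  by rewrite EE cE /T; ring.
set Y := E A' B X - _ in X0 X1 *.
have Y1 : M0 * Y <= 18 * D ^+ 4 * N1.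
  apply: le_trans (ler_wpM2l (ltW M00) X1) _.
  have -> : M0 * (9 * D ^+ 4 * q * N1) = 9 * D ^+ 4 * N1 * (M0 * q) by ring.
  have -> : 18 * D ^+ 4 * N1 = 9 * D ^+ 4 * N1 * 2 by ring.
  by rewrite ler_wpM2l ?(qM0) // !mulr_ge0 ?exprn_ge0.
have Y0 : 0 <= M0 * Y by rewrite mulr_ge0 // ltW.
have Z0 : 0 <= (T - 2) * (2 * T - 2) * N1.
  by rewrite mulr_ge0 // mulr_ge0 // /T; lra.
have Z1 : (T - 2) * (2 * T - 2) * N1 <= D ^+ 4 * N1.
  rewrite ler_wpM2r //; apply: le_trans (_ : (2 * D) * (4 * D) <= _).
    by apply: ler_pM; rewrite /T; lra.
  have -> : 2 * D * (4 * D) = 8 * D ^+ 2 by ring.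
  have -> : D ^+ 4 = D ^+ 2 * D ^+ 2 by ring.
  by rewrite ler_wpM2r ?exprn_ge0 //; have := D2_ge; have := D_ge; lra.
move: hu hv; rewrite !ler_norml => /andP[hu1 hu2] /andP[hv1 hv2].
by apply/andP; split; lra.
Qed.
End Estimates.

(** * The asymptotic statement *)

(* Dividing the double count by the total gives
   p (1 + f - rho w) = rho (1 - w) + O(delta^2 rho) with f, w, rho = O(delta). *)
Lemma ratio_estimate (R : realFieldType) (p rho w f delta : R) :
  0 <= rho -> rho <= delta -> 0 <= w -> w <= 3 * delta -> `|f| <= 6 * delta ->
  delta <= 100^-1 -> 0 <= p -> p <= 2 * rho ->
  `|p * (1 + f - rho) - rho * (1 - p) * (1 - w)|
     <= 58 * delta ^+ 2 * p + 212 * delta ^+ 2 * rho ->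
  `|p - rho * (1 - w) * (1 - f)| <= 3000 * delta ^+ 2 * (rho * (1 - w) * (1 - f)) /\
  0 <= rho * (1 - w) * (1 - f).
Proof.
move=> rho0 rhod w0 wd fd d100 p0 pr H.
have dd0 : 0 <= delta by lra.
have d2 : 0 <= delta ^+ 2 by rewrite exprn_ge0.
have dI : delta <= 1 / 100 by rewrite div1r.
move: (fd); rewrite ler_norml => /andP[f1 f2].
set m := rho * (1 - w) * (1 - f).
set c := 1 + f - rho * w.
have rw0 : 0 <= rho * w by rewrite mulr_ge0.
have rwd : rho * w <= 3 * delta ^+ 2.
  have -> : 3 * delta ^+ 2 = delta * (3 * delta) by ring.
  by rewrite ler_pM.
have d21 : delta ^+ 2 <= delta / 100.
  by rewrite expr2 ler_wpM2l //; lra.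
have c2 : 1 / 2 <= c by rewrite /c; lra.
(* Collecting the terms in [p] turns odds into a probability; 328 is 58 * 2 + 212, by
   [p <= 2 * rho]. *)
have theta : `|p * c - rho * (1 - w)| <= 328 * delta ^+ 2 * rho.
  have -> : p * c - rho * (1 - w) = p * (1 + f - rho) - rho * (1 - p) * (1 - w).
    by rewrite /c; ring.
  apply: le_trans H _.
  have : delta ^+ 2 * p <= delta ^+ 2 * (2 * rho) by rewrite ler_wpM2l.
  lra.
have f2d : f ^+ 2 <= 36 * delta ^+ 2.
  have -> : 36 * delta ^+ 2 = (6 * delta) ^+ 2 by ring.
  by rewrite -real_normK ?num_real // lerXn2r ?nnegrE //; lra.
have f20 : 0 <= f ^+ 2 by rewrite exprn_even_ge0.
have frw0 : 0 <= (1 - f) * (rho * w) by rewrite mulr_ge0 //; lra.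
have frw : (1 - f) * (rho * w) <= 2 * (3 * delta ^+ 2) by rewrite ler_pM //; lra.
have wX : 0 <= rho * (1 - w) * (f ^+ 2 + (1 - f) * (rho * w)) <= 42 * delta ^+ 2 * rho.
  apply/andP; split.
    by rewrite mulr_ge0 ?addr_ge0 // mulr_ge0 //; lra.
  have -> : 42 * delta ^+ 2 * rho = (rho * 1) * (42 * delta ^+ 2) by ring.
  apply: ler_pM; [|by rewrite addr_ge0| |lra].
    by rewrite mulr_ge0 //; lra.
  by rewrite ler_wpM2l //; lra.
(* Since (1 - f) c = 1 - f^2 - (1 - f) rho w, replacing 1 / c by 1 - f costs 36 + 6 units. Dividing
   by [c >= 1/2] and using [rho <= 4 * m] then gives 2960, below 3000. *)
have main1 : `|(p - m) * c| <= 370 * delta ^+ 2 * rho.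
  have -> : (p - m) * c = (p * c - rho * (1 - w)) +
     rho * (1 - w) * (f ^+ 2 + (1 - f) * (rho * w)) by rewrite /m /c; ring.
  apply: le_trans (ler_normD _ _) _.
  case/andP: wX => wX0 wX1; rewrite (ger0_norm wX0); lra.
have m4 : rho * (1 / 4) <= m.
  rewrite /m -mulrA ler_wpM2l //.
  have -> : 1 / 4 = (1 / 2) * (1 / 2) :> R by lra.
  by apply: ler_pM; lra.
have m0 : 0 <= m by lra.
split=> //.
have : `|p - m| * (1 / 2) <= 370 * delta ^+ 2 * rho.
  apply: le_trans main1; rewrite normrM ler_wpM2l //.
  by apply: le_trans c2 (ler_norm _).
have : delta ^+ 2 * (rho * (1 / 4)) <= delta ^+ 2 * m by rewrite ler_wpM2l.
lra.
Qed.

Lemma condprobE (R : realType) n (d : 'I_n -> nat) A B u v :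
  condprob R d A B u v = cnt R d (edge u v |: A) B / cnt R d A B.
Proof. by rewrite /condprob /cnt cond_graphsU1l. Qed.

(** Reconciles two encodings: forbidding uv in addition excludes [x = v] and [y = u], as the
    condition that [x] and [y] avoid [u] and [v] does. *)
Lemma sum_Wset (R : realType) n (d : 'I_n -> nat) A B u v :
  is_graph (A :|: B) ->
  \sum_(p in Wset A B u v) dt R d A p.1 * dt R d A p.2 / Mt R d A ^+ 2 =
  (\sum_x \sum_y ([&& edge x y \in A :|: B, u != x,
      edge u x \notin A :|: (edge u v |: B), v != y &
      edge v y \notin A :|: (edge u v |: B)])%:R * (dt R d A x * dt R d A y))
   / Mt R d A ^+ 2.
Proof.
move=> gH; rewrite -mulr_suml; congr (_ / _).
rewrite pair_big /= big_mkcond; apply: eq_bigr => -[x y] _ /=.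
rewrite inE /= /H12 !inE !edge_eq !eqxx /= !(edgeC x u) !(edgeC y v) !negb_or /=.
rewrite !(eq_sym u) !(eq_sym v).
have [->|xu] := eqVneq x u; first by rewrite /= !andbF mul0r.
have [->|xv] := eqVneq x v; first by rewrite /= !andbF mul0r.
have [->|yu] := eqVneq y u; first by rewrite /= !andbF mul0r.
have [->|yv] := eqVneq y v; first by rewrite /= !andbF mul0r.
have ifE (b : bool) (z : R) : (if b then z else 0) = b%:R * z.
  by case: b; rewrite ?mul1r ?mul0r.
by rewrite ifE andbF /= !andbT -!andbA.
Qed.

(** The explicit form, free of limits. The margin 8 pays for forbidding uv and for the seven units
    that the three-edge estimate requires. The sign of the main term allows the bound to be read as
    a relative error. *)
Theorem condprob_estimate (R : realType) n (d : 'I_n -> nat) (D : R) A B u v :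
  (forall i, (d i)%:R <= D) -> 12 <= D -> 100 * D ^+ 2 <= Mt R d A ->
  is_graph (A :|: B) -> (forall i, (deg (A :|: B) i)%:R + 8 <= D) ->
  u != v -> edge u v \notin A :|: B -> cond_graphs d A B != set0 ->
  `|condprob R d A B u v - main_term R d A B u v|
    <= 3000 * (D ^+ 2 / Mt R d A) ^+ 2 * main_term R d A B u v /\
  0 <= main_term R d A B u v.
Proof.
move=> dD D12 DM gH hdeg uv uvH cne.
(* Half of [M0] suffices for [L], as [100 * D ^+ 2 <= M0] leaves room for [4 * D ^+ 2 + 22]; it also
   gives [delta <= 1/100] below. *)
set M0 := Mt R d A in DM *; pose L := M0 / 2; pose t := dt R d A.
have uvA : edge u v \notin A by move: uvH; rewrite inE negb_or => /andP[].
have D2 : 12 * D <= D ^+ 2 := D2_ge D12.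
have Lle : L + 4 * D ^+ 2 + 22 <= M0 by rewrite /L; lra.
have Mle : M0 <= 2 * L by rewrite /L; lra.
have M00 : 0 < M0 by lra.
have hst : slack d D M0 8 A B by split=> //; rewrite -/M0 ?lexx //; lra.
set r := M0^-1; set delta := D ^+ 2 / M0; set rho := t u * t v / M0.
have r0 : 0 <= r by rewrite invr_ge0 ltW.
have rM : M0 * r = 1 by rewrite mulfV ?gt_eqF.
have tD x : t x <= D := dt_le dD A x.
have t0 x : 0 <= t x := dt_ge0 R d A x.
have a0 : 0 <= t u * t v by rewrite mulr_ge0.
have N0 : 0 < cnt R d A B by rewrite ltr0n card_gt0.
set NN := cnt R d A B in N0.
set N1 := cnt R d (edge u v |: A) B; set N2 := cnt R d A (edge u v |: B).
have NE : NN = N1 + N2 := cntD R d A B (edge u v).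
have N10 : 0 <= N1 := cnt_ge0 R d _ _.
have N20 : 0 <= N2 := cnt_ge0 R d _ _.
have N1r : N1 <= 2 * rho * NN.
  have h := cnt_edge_leq dD D12 Lle Mle (s := 6) hst uv uvH; apply: le_trans h _.
  by rewrite /L invf_div /rho ler_wpM2r ?(ltW N0) // le_eqVlt; apply/orP; left;
    apply/eqP; rewrite -/(t u) -/(t v); ring.
have pE : condprob R d A B u v = N1 / NN by exact: condprobE.
set p := N1 / NN in pE.
have NE1 : N1 = p * NN by rewrite /p divfK ?gt_eqF.
have p0 : 0 <= p by rewrite divr_ge0 // ltW.
have pr : p <= 2 * rho by rewrite ler_pdivrMr.
rewrite pE /main_term -/M0 sum_Wset // -/M0.
set M2 := M2t R d A.
have [hb W2b] := bwd_near dD D12 Lle Mle hst uv uvH.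
cbv zeta in hb, W2b.
set W2 := \sum_x _ in hb W2b *; rewrite -/M2 -/N2 -/(t u) -/(t v) in hb.
set w := M2 ^+ 2 / M0 ^+ 3 + M2 / M0 ^+ 2 + W2 / M0 ^+ 2.
set f := phibar R d A B u v / M0.
have -> : 1 - M2 ^+ 2 / M0 ^+ 3 - M2 / M0 ^+ 2 - W2 / M0 ^+ 2 = 1 - w by rewrite /w; ring.
rewrite -/(t u) -/(t v) -/rho.
(* A saturated end makes [rho] zero and forces [p = 0] through [p <= 2 * rho]. The forward estimate
   needs both residual degrees positive. *)
have [tu|tu] := ltP 0 (t u); last first.
  have rh : rho = 0 by rewrite /rho (@le_anti _ _ (t u) 0) ?tu ?t0 ?mul0r.
  have -> : p = 0 by apply: le_anti; rewrite p0 andbT; rewrite rh mulr0 in pr.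
  by rewrite rh !mul0r subrr normr0 mulr0.
have [tv|tv] := ltP 0 (t v); last first.
  have rh : rho = 0 by rewrite /rho (@le_anti _ _ (t v) 0) ?tv ?t0 ?mulr0 ?mul0r.
  have -> : p = 0 by apply: le_anti; rewrite p0 andbT; rewrite rh mulr0 in pr.
  by rewrite rh !mul0r subrr normr0 mulr0.
have hf := fwd_near dD D12 Lle Mle (s := 2) hst uv uvH tu tv (erefl _).
(* From here on both estimates concern the same sum [S], which is then eliminated by the triangle
   inequality. *)
cbv zeta in hf; rewrite (switching R d gH uv uvH) in hf.
move: hf hb; set S := Esum _ _ _ _; rewrite -/N1 -/M2 -/M0 -/(t u) -/(t v).
set Su := \sum_(x in nbr (A :|: B) u) dt R d A x.
set Sv := \sum_(x in nbr (A :|: B) v) dt R d A x.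
move=> hf hb.
have fE : f = (- 2 * (t u + t v) + 2 - Su - Sv - (t u + t v - 2) * M2 / M0 + t u * t v) / M0.
  by [].
have Mn0 : M0 != 0 by rewrite gt_eqF.
have rE (x : R) : x / M0 = x * r by [].
have rD : r * D <= r * D ^+ 2 by rewrite ler_wpM2l //; lra.
have deltaE : delta = r * D ^+ 2 by rewrite /delta rE mulrC.
have M2b : M2 <= D * M0 := M2t_le dD D12 hst.
have M20 : 0 <= M2 := M2t_ge0 R d A.
set m := M2 * r.
have m0 : 0 <= m by rewrite mulr_ge0.
have mD : m <= D by rewrite /m -rE ler_pdivrMr.
have m2D : m ^+ 2 <= D ^+ 2 by rewrite lerXn2r ?nnegrE //; lra.
have aD : t u * t v <= D ^+ 2 by rewrite expr2 ler_pM.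
have rhod : rho <= delta by rewrite /rho /delta ler_wpM2r.
have rho0 : 0 <= rho by rewrite /rho mulr_ge0.
have wE : w = r * (m ^+ 2 + m * 1 + W2 * r) by rewrite /w /m /r; field.
case/andP: W2b => W20 W21.
have W2r : W2 * r <= D ^+ 2 by rewrite -rE ler_pdivrMr.
have W2r0 : 0 <= W2 * r by rewrite mulr_ge0.
have w0 : 0 <= w.
  by rewrite wE mulr_ge0 // !addr_ge0 ?exprn_ge0 ?mulr_ge0.
have wd : w <= 3 * delta.
  rewrite wE deltaE; have -> : 3 * (r * D ^+ 2) = r * (3 * D ^+ 2) by ring.
  by rewrite ler_wpM2l //; lra.
have nbrb x : 0 <= \sum_(y in nbr (A :|: B) x) dt R d A y <= D ^+ 2.
  apply/andP; split; first by apply: sumr_ge0 => y _; exact: t0.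
  apply: le_trans (_ : \sum_y edge_ind R (A :|: B) x y * D <= _).
    rewrite big_mkcond /=; apply: ler_sum => y _; rewrite inE /edge_ind.
    by case: (_ \in _); rewrite ?mul1r ?mul0r // tD.
  by rewrite -mulr_suml expr2 ler_wpM2r ?(sum_ind_slack x hst) //; lra.
have /andP[Su0 SuD] := nbrb u; have /andP[Sv0 SvD] := nbrb v.
rewrite -/Su in Su0 SuD; rewrite -/Sv in Sv0 SvD.
have uD := tD u; have vD := tD v; have u0 := t0 u; have v0 := t0 v.
have Tm1 : (t u + t v - 2) * m <= (2 * D) * D.
  apply: le_trans (_ : 2 * D * m <= _); first by rewrite ler_wpM2r //; lra.
  by rewrite ler_wpM2l //; lra.
have Tm2 : - 2 * m <= (t u + t v - 2) * m by rewrite ler_wpM2r //; lra.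
have fE' : f = r * (- 2 * (t u + t v) + 2 - Su - Sv - (t u + t v - 2) * m + t u * t v).
  by rewrite fE /m /r; field.
have fd : `|f| <= 6 * delta.
  rewrite fE' normrM (ger0_norm r0) deltaE.
  have -> : 6 * (r * D ^+ 2) = r * (6 * D ^+ 2) by ring.
  rewrite ler_wpM2l // ler_norml; apply/andP; split; lra.
have d100 : delta <= 100^-1.
  by rewrite /delta ler_pdivrMr //; lra.
apply: ratio_estimate => //.
have hf' : `|N1 * (1 + f - rho) - S * r| <= 58 * delta ^+ 2 * N1.
  have -> : N1 * (1 + f - rho) - S * r = - r ^+ 2 * (M0 * S - N1 *
       (M0 ^+ 2 - M0 * (2 * (t u + t v) - 2 + (Su + Sv)) - (t u + t v - 2) * M2)).
    by rewrite fE /rho /r; field.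
  rewrite normrM normrN (ger0_norm (exprn_ge0 2 r0)) deltaE.
  have -> : 58 * (r * D ^+ 2) ^+ 2 * N1 = r ^+ 2 * (58 * D ^+ 4 * N1) by ring.
  by rewrite ler_wpM2l ?exprn_ge0.
have hb' : `|S * r - rho * N2 * (1 - w)| <= 212 * delta ^+ 2 * (rho * N2).
  have -> : S * r - rho * N2 * (1 - w) = r ^+ 4 * (M0 ^+ 3 * S -
     t u * t v * N2 * (M0 ^+ 3 - M2 ^+ 2 - M2 * M0 - W2 * M0)).
    by rewrite /w /rho /r; field.
  rewrite normrM (ger0_norm (exprn_ge0 4 r0)) deltaE.
  have -> : 212 * (r * D ^+ 2) ^+ 2 * (rho * N2) =
     r ^+ 4 * (212 * (D ^+ 4 * M0) * (t u * t v * N2)).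
    by rewrite /rho /r; field.
  by rewrite ler_wpM2l ?exprn_ge0.
have N2E : N2 = (1 - p) * NN by rewrite mulrBl mul1r -NE1 NE; ring.
have NN0 := ltW N0.
have N2le : N2 <= NN by rewrite NE lerDr.
rewrite -(ler_pM2r N0).
rewrite -{1}(gtr0_norm N0) -normrM.
have -> : (p * (1 + f - rho) - rho * (1 - p) * (1 - w)) * NN =
  (N1 * (1 + f - rho) - S * r) + (S * r - rho * N2 * (1 - w)).
  by rewrite N2E NE1; ring.
apply: le_trans (ler_normD _ _) _; apply: le_trans (lerD hf' hb') _.
rewrite [leRHS]mulrDl; apply: lerD; first by rewrite NE1 mulrA.
by rewrite -[leRHS]mulrA !ler_wpM2l // mulr_ge0 ?exprn_ge0 // (le_trans rho0).
Qed.

Theorem theorem2p4 (R : realType) (N : nat -> nat)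
  (d : forall k, 'I_(N k) -> nat)
  (H1 H2 : forall k, {set {set 'I_(N k)}})
  (u v : forall k, 'I_(N k)) :
  (* n = N k -> oo *)
  (forall m : nat, exists K : nat, forall k, (K <= k)%N -> (m <= N k)%N) ->
  (* M even *)
  (forall k, ~~ odd (sumdeg (d k))) ->
  (* Delta^2 = o(M) *)
  littleo (fun k => ((Delta (d k)) ^ 2)%:R : R) (fun k => (sumdeg (d k))%:R) ->
  (* H1, H2 graphs on [n] with disjoint edge sets *)
  (forall k, is_graph (H1 k)) ->
  (forall k, is_graph (H2 k)) ->
  (forall k, [disjoint H1 k & H2 k]) ->
  (* d^{H1}_i <= d_i *)
  (forall k i, (deg (H1 k) i <= d k i)%N) ->
  (* max degree of H2 is O(Delta) *)
  bigO (fun k => (maxdeg (H2 k))%:R : R) (fun k => (Delta (d k))%:R) ->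
  (* \tilde M = Omega(M) *)
  bigO (fun k => (sumdeg (d k))%:R : R) (fun k => Mt R (d k) (H1 k)) ->
  (* uv is a pair of distinct vertices with uv \notin H1 \cup H2 *)
  (forall k, u k != v k) ->
  (forall k, edge (u k) (v k) \notin H1 k :|: H2 k) ->
  (* the conditioning event H1^+, H2^- has positive probability *)
  (forall k, cond_graphs (d k) (H1 k) (H2 k) != set0) ->
  exists C : R, exists K : nat, forall k, (K <= k)%N ->
    exists err : R,
      `|err| <= C * (((Delta (d k)) ^ 5 * N k)%:R / ((sumdeg (d k)) ^ 3)%:R) /\
      condprob R (d k) (H1 k) (H2 k) (u k) (v k)
        = (1 + err) * main_term R (d k) (H1 k) (H2 k) (u k) (v k).
Proof.
move=> _ _ hlit gH1 gH2 _ _ hdH2 hM uv uvH cne.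
have [C2 [C20 [K2 hC2]]] := hdH2.
have [CM [CM0 [KM hCM]]] := hM.
(* [D] will be c Delta: for Delta >= 1 it dominates both 12 and Delta + C2 Delta + 8, a bound for
   the degrees in the union plus the margin. *)
pose c := C2 + 20; have c0 : 0 < c by rewrite /c; lra.
(* Chosen so that Delta^2 = o(M) and M <= CM [Mt0] together give [100 * D ^+ 2 <= Mt0]. *)
have eps0 : 0 < (100 * c ^+ 2 * CM)^-1 by rewrite invr_gt0 !mulr_gt0 ?exprn_gt0.
have [Kl hl] := hlit _ eps0.
exists (3000 * c ^+ 4 * CM ^+ 2), (maxn K2 (maxn KM Kl)) => k.
rewrite !geq_max => /and3P[k2 kM kl].
have := hC2 k k2; have := hCM k kM; have := hl k kl.
rewrite !ger0_norm ?ler0n ?Mt_ge0 //.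
set De := Delta (d k); set Ms := sumdeg (d k); set Mt0 := Mt R (d k) (H1 k).
have dDe i : (d k i <= De)%N by exact: leq_bigmax.
rewrite natrX => l1 l2 l3.
(* With all degrees zero both sides vanish and the error is taken to be 0; otherwise Delta >= 1. *)
have [De0|De0] := posnP De.
  exists 0; rewrite normr0 De0 exp0n // mul0n mul0r mulr0; split=> //.
  have d0 i : dt R (d k) (H1 k) i = 0.
    by have := dDe i; rewrite De0 leqn0 /dt => /eqP->.
  rewrite condprobE (_ : cnt _ _ _ _ = 0); last first.
    apply/eqP; rewrite /cnt pnatr_eq0 cards_eq0; apply/set0Pn => -[G].
    rewrite in_condU1l => /andP[GS uvG].
    have /condP[_ hd _ _] := GS.
    have := hd (u k); have := dDe (u k); rewrite De0 leqn0 => /eqP-> /eqP.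
    rewrite cards_eq0 => /eqP/setP/(_ (edge (u k) (v k))).
    by rewrite !inE uvG eqxx.
  by rewrite /main_term d0 !mul0r mulr0.
have De1 : 1 <= De%:R :> R by rewrite ler1n.
pose D := c * De%:R.
have D2E : D ^+ 2 = c ^+ 2 * De%:R ^+ 2 by rewrite /D exprMn.
have ce0 : 0 < 100 * c ^+ 2 * CM by rewrite !mulr_gt0 ?exprn_gt0.
have hD2 : 100 * D ^+ 2 <= Mt0.
  rewrite mulrC ler_pdivlMr // in l1.
  have h : De%:R ^+ 2 * (100 * c ^+ 2 * CM) <= CM * Mt0 by exact: le_trans l1 l2.
  rewrite -(ler_pM2l CM0); apply: le_trans h; rewrite D2E le_eqVlt; apply/orP; left.
  by apply/eqP; ring.
have De2 : C2 * De%:R + 20 * De%:R = D by rewrite /D /c; ring.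
have C2D : 0 <= C2 * De%:R by rewrite mulr_ge0 // ltW.
have gH : is_graph (H1 k :|: H2 k).
  apply/is_graphP => e /setUP[]; first exact: (is_graphP _ (gH1 k)).
  exact: (is_graphP _ (gH2 k)).
have dgH i : (deg (H1 k :|: H2 k) i)%:R + 8 <= D.
  have h1 : (deg (H1 k :|: H2 k) i <= deg (H1 k) i + deg (H2 k) i)%N.
    apply: leq_trans (leq_card_setU _ _); apply/subset_leq_card/subsetP => e.
    by rewrite !inE -andb_orl.
  have h2 : (deg (H2 k) i <= maxdeg (H2 k))%N by exact: leq_bigmax.
  have h3 : (deg (H1 k) i <= De)%N.
    have [G] := set0Pn _ (cne k); rewrite in_cond => /and4P[_ /forallP/(_ i)/eqP hd HG _].
    apply: leq_trans (dDe i); rewrite -hd; apply/subset_leq_card/subsetP => e.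
    by rewrite !inE => /andP[/(subsetP HG) -> ->].
  have : (deg (H1 k :|: H2 k) i)%:R <= De%:R + (maxdeg (H2 k))%:R :> R.
    by rewrite -natrD ler_nat (leq_trans h1) // leq_add.
  lra.
have D12 : 12 <= D by lra.
have dD i : (d k i)%:R <= D.
  have : (d k i)%:R <= De%:R :> R by rewrite ler_nat.
  lra.
have [est m0] := condprob_estimate dD D12 hD2 gH dgH (uv k) (uvH k) (cne k).
rewrite -/Mt0 in est.
set m := main_term _ _ _ _ _ _ in est m0 *; set p := condprob _ _ _ _ _ _ in est *.
have DeMs : (De <= Ms)%N.
  by apply/bigmax_leqP => i _; rewrite /Ms /sumdeg (bigD1 i) //= leq_addr.
have MsN : (Ms <= N k * De)%N.
  apply: leq_trans (_ : \sum_(i < N k) De <= _)%N; first by apply: leq_sum => i _.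
  by rewrite sum_nat_const card_ord.
have Ms0 : 0 < Ms%:R :> R by rewrite ltr0n (leq_trans De0).
have Mt00 : 0 < Mt0 by rewrite -(pmulr_rgt0 _ CM0); apply: lt_le_trans l2.
set E := (_ %:R / _ %:R).
have x0 : 0 <= D ^+ 2 / Mt0 by rewrite divr_ge0 ?exprn_ge0 ?ltW //; lra.
have xle : D ^+ 2 / Mt0 <= c ^+ 2 * CM * (De%:R ^+ 2 / Ms%:R).
  rewrite ler_pdivrMr // D2E.
  have -> : c ^+ 2 * CM * (De%:R ^+ 2 / Ms%:R) * Mt0 =
    c ^+ 2 * De%:R ^+ 2 * (CM * Mt0 / Ms%:R) by ring.
  rewrite ler_peMr ?mulr_ge0 ?exprn_ge0 ?ler0n ?(ltW c0) //.
  by rewrite ler_pdivlMr // mul1r.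
have yle : (De%:R ^+ 2 / Ms%:R) ^+ 2 <= E.
  rewrite /E natrM !natrX ler_pdivlMr ?exprn_gt0 //.
  have -> : (De%:R ^+ 2 / Ms%:R) ^+ 2 * Ms%:R ^+ 3 = De%:R ^+ 4 * Ms%:R :> R.
    by field; rewrite gt_eqF.
  have -> : De%:R ^+ 5 * (N k)%:R = De%:R ^+ 4 * ((N k)%:R * De%:R) :> R by ring.
  by rewrite ler_wpM2l ?exprn_ge0 ?ler0n // -natrM ler_nat.
have bnd : 3000 * (D ^+ 2 / Mt0) ^+ 2 <= 3000 * c ^+ 4 * CM ^+ 2 * E.
  have -> : 3000 * c ^+ 4 * CM ^+ 2 * E = 3000 * ((c ^+ 2 * CM) ^+ 2 * E) by ring.
  rewrite ler_wpM2l // (le_trans (_ : _ <= (c ^+ 2 * CM * (De%:R ^+ 2 / Ms%:R)) ^+ 2)) //.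
    by rewrite lerXn2r ?nnegrE // (le_trans x0).
  by rewrite exprMn ler_wpM2l // exprn_ge0 // mulr_ge0 ?exprn_ge0 ?ltW.
(* If the main term vanishes, the estimate forces [p = 0], and the error 0 serves; otherwise it is
   defined by division. *)
have [mz|mn0] := eqVneq m 0.
  exists 0; split; last first.
    by apply/eqP; rewrite mz mulr0 -normr_eq0 eq_le normr_ge0 andbT -[p]subr0 -{1}mz
      (le_trans est) // mz mulr0.
  by rewrite normr0 (le_trans _ bnd) // mulr_ge0 // exprn_ge0.
have mp : 0 < m by rewrite lt_def mn0.
exists (p / m - 1); split; last by rewrite addrCA subrr addr0 divfK.
apply: le_trans bnd.
have -> : p / m - 1 = (p - m) / m by rewrite mulrBl divff.
by rewrite normrM normfV (gtr0_norm mp) ler_pdivrMr.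
Qed.
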